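(* Let $T$ be a tree on the vertex set $[n]$ with at least one edge. Orient each edge of $T$. For each edge $e$, oriented $s\to t$, take two variables $x_e,y_e$; deleting $e$ disconnects $T$ into two parts, and $x_e$ is associated to all vertices in the connected component of $s$ and $y_e$ to all vertices in the connected component of $t$. For a vertex $v$ write $v(e)=x$ if $x_e$ is associated to $v$ and $v(e)=y$ if $y_e$ is associated to $v$. Let $M$ be the labelling of the vertices of $T$ by the monomials $$M_v=\prod_{e:\,v(e)=x}x_e\cdot\prod_{e:\,v(e)=y}y_e$$ in the polynomial ring over $k$ in the $2(n-1)$ variables $x_e,y_e$. Then in $\mathrm{CM}(T)$ there is, up to isomorphism, a unique maximal object, given by the labelling $M$. Moreover, for every monomial labelling $L$ in $\mathrm{CM}(T)$ there is a unique morphism $M\to L$ in $\mathrm{CM}(T)$.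
   Context: Fix a field $k$; $\mathbb N$ contains $0$. Identify $k[x_1,\dots,x_r]$ with the semigroup ring $k[\mathbb N^r]$. An object of $\mathrm{CM}(T)$ is a pair $(\mathbb N^r,\mathbf a)$, where $\mathbf a=(\mathbf a_1,\dots,\mathbf a_n)$ is an $n$-tuple of elements of $\mathbb N^r$, i.e. an ordered set of monomials $m_i=\mathbf x^{\mathbf a_i}$ in $S=k[x_1,\dots,x_r]$, such that no $m_i$ divides $m_j$ for $i\neq j$, the ring $S/(m_1,\dots,m_n)$ is Cohen-Macaulay of codimension $2=\dim T+1$, and, labelling vertex $i$ of $T$ by $m_i$ and edge $\{i,j\}$ by $m_{ij}=\mathrm{lcm}(m_i,m_j)$, the cellular complex $$0\to\bigoplus_{\{i,j\}\in T}Se_{i,j}\to\bigoplus_{i}Se_i\to S,\qquad e_i\mapsto m_i,\quad e_{i,j}\mapsto\tfrac{m_{ij}}{m_j}e_j-\tfrac{m_{ij}}{m_i}e_i$$ (edges oriented arbitrarily) is a minimal free resolution of $S/(m_1,\dots,m_n)$. A morphism $(\mathbb N^r,\mathbf a)\to(\mathbb N^s,\mathbf b)$ is a semigroup (monoid) homomorphism $\phi:\mathbb N^r\to\mathbb N^s$ with $\phi(\mathbf a_i)=\mathbf b_i$ for all $i$. An object $(\mathbb N^r,\mathbf a)$ of $\mathrm{CM}(T)$ is maximal if for every morphism $\phi:(\mathbb N^s,\mathbf b)\to(\mathbb N^r,\mathbf a)$ in $\mathrm{CM}(T)$, the map $\mathbb N^s\to\mathbb N^r$ is surjective and there is a splitting,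 i.e. a morphism $\psi:(\mathbb N^r,\mathbf a)\to(\mathbb N^s,\mathbf b)$ with $\phi\circ\psi=\mathrm{id}_{\mathbb N^r}$. *)

(* Defs.v *)
From mathcomp Require Import all_boot all_order all_algebra.
From mathcomp Require Import mpoly.

Set Implicit Arguments.
Unset Strict Implicit.
Unset Printing Implicit Defensive.
Import GRing.Theory.
Local Open Scope ring_scope.

Section CommutativeAlgebra.
Variable R : comNzRingType.
Implicit Types I J P : R -> Prop.

Definition subideal I J := forall x, I x -> J x.

Definition is_ideal J :=
  [/\ J 0, forall x y, J x -> J y -> J (x + y)
    & forall a x, J x -> J (a * x)].

Definition is_prime P :=
  [/\ is_ideal P, ~ P 1 & forall x y, P (x * y) -> P x \/ P y].

Definition is_maximal P :=
  [/\ is_ideal P, ~ P 1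
    & forall J, is_ideal J -> subideal P J -> J 1 \/ subideal J P].

Definition zero_ideal : R -> Prop := fun x => x = 0.

Definition ideal_gen (A : finType) (f : A -> R) : R -> Prop :=
  fun x => exists c : A -> R, x = \sum_i c i * f i.

Definition ideal_add I (s : seq R) : R -> Prop :=
  fun x => exists y (c : 'I_(size s) -> R), I y /\ x = y + \sum_i c i * s`_i.

(* Everything below is relative to an ideal I and concerns the ring R/I:
   ideals of R/I are represented by the ideals of R containing I, and elements
   of R/I by their lifts to R. *)

(* A chain p 0 < ... < p d = P of primes of R/I. *)
Definition prime_chain I P (d : nat) (p : nat -> R -> Prop) :=
  [/\ forall i, (i <= d)%N -> is_prime (p i) /\ subideal I (p i),
      forall i, (i < d)%N ->
        subideal (p i) (p i.+1) /\ ~ subideal (p i.+1) (p i)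
    & forall x, p d x <-> P x].

Definition has_height I P (d : nat) :=
  (exists p, prime_chain I P d p) /\
  (forall d' p, prime_chain I P d' p -> (d' <= d)%N).

Definition regular_seq I (s : seq R) :=
  ~ ideal_add I s 1 /\
  forall i, (i < size s)%N -> forall g,
    ideal_add I (take i s) (s`_i * g) -> ideal_add I (take i s) g.

(* The supremum of the lengths of R/I-regular sequences in P is d. *)
Definition has_depth I P (d : nat) :=
  (exists s : seq R,
     [/\ regular_seq I s, forall i, (i < size s)%N -> P s`_i & size s = d]) /\
  (forall s : seq R,
     regular_seq I s -> (forall i, (i < size s)%N -> P s`_i) ->
     (size s <= d)%N).

(* For R Noetherian: R/I is Cohen-Macaulay when the depth of every maximal
   ideal of R/I equals its height. *)
Definition cohen_macaulay_quo I :=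
  forall P, is_maximal P -> subideal I P ->
  exists d, has_height I P d /\ has_depth I P d.

(* The codimension (height) of I: the least height, in R, of a prime
   containing I. *)
Definition has_codim I (d : nat) :=
  (exists P, [/\ is_prime P, subideal I P & has_height zero_ideal P d]) /\
  (forall P d', is_prime P -> subideal I P -> has_height zero_ideal P d' ->
     (d <= d')%N).

End CommutativeAlgebra.

Section Trees.
Variable n : nat.
Implicit Types T o : rel 'I_n.

Definition is_tree T :=
  [/\ ssrbool.symmetric T, irreflexive T, (0 < n)%N,
      forall u v, connect T u v
    & forall c : seq 'I_n, ucycle T c -> (size c <= 2)%N].

Definition is_orientation T o :=
  (forall s t, T s t = o s t || o t s) /\ (forall s t, ~~ (o s t && o t s)).

(* An oriented edge s -> t is the pair (s, t). *)
Definition edge o : Type := {p : 'I_n * 'I_n | o p.1 p.2}.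

Definition src o (e : edge o) : 'I_n := (val e).1.
Definition tgt o (e : edge o) : 'I_n := (val e).2.

Definition incr_orientation T : rel 'I_n := [rel i j | T i j && (i < j)%N].

End Trees.

Section CellularComplex.
Variables (k : fieldType) (n r : nat) (o : rel 'I_n) (a : 'I_n -> 'X_{1..r}).
Local Notation S := {mpoly k[r]}.

Definition labelling_ideal : S -> Prop :=
  ideal_gen (fun i : 'I_n => 'X_[a i] : S).

(* The complex is 0 -> S^E -> S^n -> S with maps d2 and d1; d2 sends the basis
   element of an edge i -> j to (m_ij / m_j) e_j - (m_ij / m_i) e_i. *)
Definition edge_label (e : edge o) : 'X_{1..r} := mlcm (a (src e)) (a (tgt e)).

Definition d1 (u : {ffun 'I_n -> S}) : S := \sum_i u i * 'X_[a i].

Definition d2_coef (e : edge o) (v : 'I_n) : S :=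
  if v == tgt e then 'X_[edge_label e - a v]
  else if v == src e then - 'X_[edge_label e - a v]
  else 0.

Definition d2 (w : {ffun edge o -> S}) : {ffun 'I_n -> S} :=
  [ffun v => \sum_(e : edge o) w e * d2_coef e v].

(* Minimality: the matrices of d1 and d2 have entries in (x_1, ..., x_r). *)
Definition cellular_minimal_free_resolution :=
  [/\ forall w, d2 w = 0 -> w = 0,
      forall u, d1 u = 0 <-> exists w, u = d2 w,
      forall v, ideal_gen (fun i : 'I_r => 'X_i : S) 'X_[a v]
    & forall e v, ideal_gen (fun i : 'I_r => 'X_i : S) (d2_coef e v)].

End CellularComplex.
Arguments labelling_ideal k {n r} a _.

Section CM.
Variables (k : fieldType) (n : nat) (T : rel 'I_n).

(* (N^r, a) is an object of CM(T); the edges of the cellular complex are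
   oriented increasingly. *)
Definition in_CM (r : nat) (a : 'I_n -> 'X_{1..r}) :=
  [/\ forall i j, i != j -> ~~ (a i <= a j)%MM,
      cohen_macaulay_quo (labelling_ideal k a),
      has_codim (labelling_ideal k a) 2
    & cellular_minimal_free_resolution k (incr_orientation T) a].

Definition is_morphism (r s : nat) (a : 'I_n -> 'X_{1..r})
    (b : 'I_n -> 'X_{1..s}) (phi : 'X_{1..r} -> 'X_{1..s}) :=
  [/\ phi 0%MM = 0%MM, forall u v, phi (u + v)%MM = (phi u + phi v)%MM
    & forall i, phi (a i) = b i].

Definition isomorphic (r s : nat) (a : 'I_n -> 'X_{1..r})
    (b : 'I_n -> 'X_{1..s}) :=
  exists phi psi, [/\ is_morphism a b phi, is_morphism b a psi,
                      cancel phi psi & cancel psi phi].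

Definition maximal_object (r : nat) (a : 'I_n -> 'X_{1..r}) :=
  in_CM a /\
  forall (s : nat) (b : 'I_n -> 'X_{1..s}), in_CM b ->
  forall phi, is_morphism b a phi ->
    (forall u, exists v, phi v = u) /\
    (exists psi, is_morphism a b psi /\ cancel psi phi).

End CM.

Section TreeLabelling.
Variables (n : nat) (T o : rel 'I_n).

Definition delete_edge (e : edge o) : rel 'I_n :=
  [rel u v | [&& T u v, (u, v) != (src e, tgt e) & (u, v) != (tgt e, src e)]].

(* v(e) = x, respectively v(e) = y. *)
Definition on_x_side (e : edge o) (v : 'I_n) := connect (delete_edge e) (src e) v.
Definition on_y_side (e : edge o) (v : 'I_n) := connect (delete_edge e) (tgt e) v.

(* The variables x_e and y_e; their number is 2(n - 1) when T is a tree. *)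
Definition num_vars := #|{: edge o + edge o}|.
Definition x_var (e : edge o) : 'I_num_vars := enum_rank (inl e).
Definition y_var (e : edge o) : 'I_num_vars := enum_rank (inr e).

Definition tree_labelling (v : 'I_n) : 'X_{1..num_vars} :=
  (\sum_(e : edge o | on_x_side e v) U_(x_var e)
   + \sum_(e : edge o | on_y_side e v) U_(y_var e))%MM.

End TreeLabelling.

(* Main.v *)
(** The morphism from M to an object L sends x_e, for e = s -> t, to
    lcm(L_s, L_t) / L_t and y_e to lcm(L_s, L_t) / L_s.  It maps M_v to L_v up
    to a common factor of all labels: exactness of the cellular complex makes
    every coordinate of L monotone along the paths leaving a vertex where it is
    minimal, and codimension 2 makes these minima 0.  It is unique because M_s
    and M_t differ only by the exchange of x_e and y_e.  Maximality of M and
    uniqueness of maximal objects are then formal, once M is in CM(T).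

    For this last point, the complex is exact because sum_(v on one side of e)
    u_v M_v is divisible by lcm(M_s, M_t) whenever sum_v u_v M_v = 0.  Let I be
    the ideal of the M_v.  By the Helly property of subtrees every prime
    containing I contains one of the ideals (z, z') whose two variables cover
    T, and I is the intersection of these.  Successive colon ideals by variables
    filter S/I by rings S/(z, z'), on which a common regular sequence of the
    right length is found inside any maximal ideal: the elementary symmetric
    functions of polynomials F_j(x_j) in that ideal that vanish at 0, which
    exist by Zariski's lemma.  Upper bounds for heights and depths come from
    counting monomials: more than N elements of k[x_1, ..., x_N] are
    algebraically dependent. *)
Require Import Defs.
From HB Require Import structures.
From mathcomp Require Import all_boot all_order all_algebra.
From mathcomp Require Import mpoly ring zify.
From Stdlib Require Import Classical ClassicalEpsilon.
From Stdlib Require Import FunctionalExtensionality PropExtensionality.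

Set Implicit Arguments.
Unset Strict Implicit.
Unset Printing Implicit Defensive.
Import GRing.Theory.
Local Open Scope ring_scope.

(** * Regular sequences and chains of ideals *)

Section Ideals.
Variable R : comNzRingType.
Implicit Types (I J : R -> Prop) (s t : seq R) (g h x : R).

Definition adjoin J h x := exists y c, J y /\ x = y + c * h.
Definition colon J g x := J (x * g).
Definition nzd J h := forall g, J (h * g) -> J g.

(** Regularity without properness: it holds trivially for the unit ideal, so it passes through
    filtrations in which some quotients may vanish. *)
Fixpoint weakly_regular J s :=
  if s is h :: t then nzd J h /\ weakly_regular (adjoin J h) t else True.

Lemma ideal_ext I J : (forall x, I x <-> J x) -> I = J.
Proof.
move=> h; apply functional_extensionality => x.
exact/propositional_extensionality/h.
Qed.

Lemma idealN J x : is_ideal J -> J x -> J (- x).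
Proof. by case=> _ _ hM hx; rewrite -mulN1r; apply: hM. Qed.

Lemma idealB J x y : is_ideal J -> J x -> J y -> J (x - y).
Proof.
by move=> hJ hx hy; have [_ hD _] := hJ; apply: hD; last exact: idealN.
Qed.

Lemma ideal_mulr J x c : is_ideal J -> J x -> J (x * c).
Proof. by case=> _ _ hM hx; rewrite mulrC; apply: hM. Qed.

Lemma ideal_sum J (A : Type) (r : seq A) (P : pred A) (f : A -> R) :
  is_ideal J -> (forall i, P i -> J (f i)) -> J (\sum_(i <- r | P i) f i).
Proof. by case=> h0 hD _ hf; apply: big_ind. Qed.

Lemma is_ideal_adjoin J h : is_ideal J -> is_ideal (adjoin J h).
Proof.
case=> h0 hD hM; split.
- by exists 0, 0; rewrite mul0r addr0.
- move=> _ _ [y [c [hy ->]]] [z [d [hz ->]]]; exists (y + z), (c + d).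
  by split; [exact: hD | ring].
- move=> a _ [y [c [hy ->]]]; exists (a * y), (a * c).
  by split; [exact: hM | ring].
Qed.

Lemma sub_adjoin J h x : J x -> adjoin J h x.
Proof. by move=> hx; exists x, 0; rewrite mul0r addr0. Qed.

Lemma mem_adjoin J h : is_ideal J -> adjoin J h h.
Proof. by case=> h0 _ _; exists 0, 1; rewrite mul1r add0r. Qed.

Lemma adjoin_sub I J h :
  is_ideal J -> subideal I J -> J h -> subideal (adjoin I h) J.
Proof.
case=> h0 hD hM hI hh x [y [c [/hI hy ->]]].
by apply: hD; last exact: hM.
Qed.

Lemma adjoinC J g h : adjoin (adjoin J g) h = adjoin (adjoin J h) g.
Proof.
have sub a b : subideal (adjoin (adjoin J a) b) (adjoin (adjoin J b) a).
  move=> x [_ [c [[y [d [hy ->]]] ->]]].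
  by exists (y + c * b), d; split; [exists y, c | ring].
by apply: ideal_ext => x; split; apply: sub.
Qed.

Lemma adjoin_mod J g h : is_ideal J -> J (g - h) -> adjoin J g = adjoin J h.
Proof.
move=> hJ; have sub a b : J (a - b) -> subideal (adjoin J a) (adjoin J b).
  move=> hab; apply: adjoin_sub; first exact: is_ideal_adjoin.
    exact: sub_adjoin.
  by exists (a - b), 1; split=> //; ring.
move=> hgh; apply: ideal_ext => x; split; first exact: sub.
by apply: sub; rewrite -opprB; apply: idealN.
Qed.

Lemma adjoin1 J x : is_ideal J -> adjoin J 1 x.
Proof. by case=> h0 _ _; exists 0, x; rewrite mulr1 add0r. Qed.

Lemma nzdM J g h : nzd J g -> nzd J h -> nzd J (g * h).
Proof. by move=> hg hh x; rewrite -mulrA => /hg /hh. Qed.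

Lemma nzdX J h a : nzd J h -> nzd J (h ^+ a).
Proof.
move=> hh; elim: a => [|a IH] x; first by rewrite mul1r.
by rewrite exprS -mulrA => /hh /IH.
Qed.

Lemma nzd_mod J g h : is_ideal J -> J (g - h) -> nzd J g -> nzd J h.
Proof.
move=> hJ hgh hg x hx; apply: hg; case: (hJ) => _ hD _.
have -> : g * x = (g - h) * x + h * x by ring.
by apply: hD => //; exact: ideal_mulr.
Qed.

Lemma weakly_regular_top J s : (forall x, J x) -> weakly_regular J s.
Proof.
elim: s J => //= h t IH J hJ; split; first by move=> *.
by apply: IH => x; apply: sub_adjoin.
Qed.

(* Multiplication by [g] makes R/(J : g) a submodule of R/J with quotient
   R/(J + g), and a sequence regular on both ends is regular in the middle. *)
Lemma weakly_regular_colon_adjoin J g s : is_ideal J ->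
  weakly_regular (colon J g) s -> weakly_regular (adjoin J g) s ->
  weakly_regular J s.
Proof.
elim: s J => //= h t IH J hJ [nc wc] [na wa].
have nJ : nzd J h.
  move=> f hf; have [y [c [hy ef]]] := na f (sub_adjoin g hf).
  rewrite ef; case: (hJ) => _ hD hM; apply: hD => //.
  apply: (nc c); rewrite /colon.
  have -> : h * c * g = h * f - h * y by rewrite ef; ring.
  by apply: idealB => //; apply: hM.
split=> //; apply: IH; first exact: is_ideal_adjoin; last by rewrite adjoinC.
(* Colon and adjunction commute here because [h] is a nonzerodivisor modulo J + (g): if f g = y + c
   h with y in J, then c lies in J + (g), say c = z + d g, and (f - d h) g is in J. *)
rewrite (_ : colon (adjoin J h) g = adjoin (colon J g) h) //.
apply: ideal_ext => f; split.
- move=> [y [c [hy ef]]].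
  have [z [d [hz ec]]] : adjoin J g c.
    by apply: na; exists (- y), f; split; [exact: idealN | rewrite ef; ring].
  exists (f - d * h), d; split; last by ring.
  rewrite /colon; case: (hJ) => _ hD hM.
  have -> : (f - d * h) * g = y + h * z by rewrite mulrBl ef ec; ring.
  by apply: hD => //; apply: hM.
- move=> [y [c [hy ->]]]; exists (y * g), (c * g); split=> //; ring.
Qed.

Lemma ideal_add_nil J : ideal_add J [::] = J.
Proof.
apply: ideal_ext => x; split=> [[y [c [hy ->]]]|hx].
  by rewrite big_ord0 addr0.
by exists x, (fun=> 0); rewrite big_ord0 addr0.
Qed.

Lemma ideal_add_cons J h t : ideal_add J (h :: t) = ideal_add (adjoin J h) t.
Proof.
apply: ideal_ext => x; split=> -[y [c [hy ->]]].
  exists (y + c ord0 * h), (fun i => c (lift ord0 i)); split.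
    by exists y, (c ord0).
  by rewrite big_ord_recl addrA.
have [z [d [hz ->]]] := hy.
exists z, (fun i => if unlift ord0 i is Some j then c j else d); split=> //.
rewrite big_ord_recl unlift_none -addrA; congr (_ + (_ + _)).
by apply: eq_bigr => i _; rewrite liftK.
Qed.

Lemma ideal_add_sub I J s : is_ideal J -> subideal I J ->
  (forall i, (i < size s)%N -> J s`_i) -> subideal (ideal_add I s) J.
Proof.
move=> hJ hI hs x [y [c [hy ->]]]; case: (hJ) => _ hD hM.
apply: hD; first exact: hI.
by apply: ideal_sum => // i _; apply/hM/hs.
Qed.

Lemma regular_seqP J s :
  regular_seq J s <-> ~ ideal_add J s 1 /\ weakly_regular J s.
Proof.
rewrite /regular_seq; split=> -[h1 h2]; split=> // {h1}.
  elim: s J h2 => //= h t IH J hs; split.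
    by move=> g hg; have := hs 0%N isT g; rewrite take0 ideal_add_nil; apply.
  apply: IH => i hi g hg; have := hs i.+1 hi g.
  by rewrite /= ideal_add_cons; apply.
elim: s J h2 => //= h t IH J [n w] [|i] hi g.
  by rewrite take0 ideal_add_nil; apply: n.
by rewrite /= ideal_add_cons; apply: IH.
Qed.

(* The common feature of a regular sequence on R/J and of a strictly increasing
   chain of primes starting at J. *)
Fixpoint nzd_chain J s :=
  if s is h :: t then
    exists J', [/\ is_ideal J', subideal J J', J' h, nzd J h & nzd_chain J' t]
  else ~ J 1.

(* [lexval s x]: x is the value at s of a polynomial whose lexicographically
   smallest nonzero coefficient is a unit, except that the coefficients of the
   higher terms are arbitrary ring elements. *)
Fixpoint lexval s x :=
  if s is h :: t then exists a y r, lexval t y /\ x = h ^+ a * (y + h * r)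
  else exists u, u * x = 1.

(** The power of [h] cancels modulo [J], and what remains of [x] agrees with [y] modulo [h], an
    element of [J']. *)
Lemma lexval_cons J J' h t x : is_ideal J' -> subideal J J' -> J' h ->
  nzd J h -> lexval (h :: t) x -> J x -> exists y, lexval t y /\ J' y.
Proof.
move=> hJ' hs hh nh [a [y [r [hy ->]]]] /(nzdX nh) /hs h'.
exists y; split=> //; rewrite -(addrK (h * r) y).
by apply: idealB => //; apply: ideal_mulr.
Qed.

(** Otherwise [lexval_cons], applied along the chain, would put a unit into its last ideal. Once 0
    is such a value, as for long sequences in a polynomial ring, no chain exists. *)
Lemma lexval_nzd_chain J s x :
  is_ideal J -> nzd_chain J s -> lexval s x -> ~ J x.
Proof.
elim: s J x => [|h t IH] J x hJ.
  by move=> /= n1 [u hu] hx; apply: n1; rewrite -hu; case: hJ => _ _; apply.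
move=> [J' [hJ' hs hh nh ct]] hx hJx.
have [y [hy hy']] := lexval_cons hJ' hs hh nh hx hJx.
exact: IH ct hy hy'.
Qed.

Lemma lexvalM s x y : lexval s x -> lexval s y -> lexval s (x * y).
Proof.
elim: s x y => [|h t IH] x y /=.
  by move=> [u hu] [v hv]; exists (u * v); rewrite mulrACA hu hv mulr1.
move=> [a [x' [r [hx ->]]]] [b [y' [q [hy ->]]]].
exists (a + b)%N, (x' * y'), (x' * q + r * y' + h * r * q).
by split; [exact: IH | rewrite exprD; ring].
Qed.

Lemma lexval1 s : lexval s 1.
Proof.
elim: s => [|h t IH] /=; first by exists 1; rewrite mulr1.
by exists 0%N, 1, 0; rewrite mulr0 addr0 mulr1.
Qed.

Lemma lexval_prod s (A : Type) (r : seq A) (P : pred A) (f : A -> R) :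
  (forall i, P i -> lexval s (f i)) -> lexval s (\prod_(i <- r | P i) f i).
Proof. by move=> hf; apply: big_ind => //; [exact: lexval1|exact: lexvalM]. Qed.

Lemma weakly_regular_nzd_chain J s :
  is_ideal J -> regular_seq J s -> nzd_chain J s.
Proof.
move=> hJ /regular_seqP [].
elim: s J hJ => [|h t IH] J hJ; first by rewrite ideal_add_nil.
rewrite ideal_add_cons /= => h1 [nh wt]; exists (adjoin J h); split=> //.
- exact: is_ideal_adjoin.
- exact: sub_adjoin.
- exact: mem_adjoin.
- exact: IH (is_ideal_adjoin _ hJ) h1 wt.
Qed.

Lemma prime_nzd P h : is_prime P -> ~ P h -> nzd P h.
Proof. by case=> _ _ hM nh g /hM []. Qed.

(* Choosing elements of the successive differences of a prime chain. *)
Lemma prime_chain_nzd_chain I P d p : prime_chain I P d p ->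
  exists s, size s = d /\
    forall J t, J = P -> nzd_chain J t -> nzd_chain (p 0%N) (s ++ t).
Proof.
elim: d p I => [|d IH] p I [hp hs he].
  by exists [::]; split=> // J t ->; rewrite (ideal_ext he).
have [] := IH (fun i => p i.+1) I.
  by split=> [i hi|i hi|//]; [exact: hp | exact: hs].
move=> s [hsz hc]; have [h01 h10] := hs 0%N isT.
have [h hh] := not_all_ex_not _ _ h10.
have [h1 h0] := imply_to_and _ _ hh.
exists (h :: s); split; first by rewrite /= hsz.
move=> J t eJ ct /=; exists (p 1%N); split=> //.
- by case: (hp 1%N isT) => -[].
- by apply: prime_nzd => //; case: (hp 0%N isT).
- exact: hc eJ ct.
Qed.

End Ideals.

(** * Monomial ideals *)

Lemma prime_ker (R : comNzRingType) (S : idomainType) (f : {rmorphism R -> S}) :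
  is_prime (fun x => f x = 0).
Proof.
split; first split.
- exact: rmorph0.
- by move=> x y hx hy; rewrite rmorphD hx hy addr0.
- by move=> a x hx; rewrite rmorphM hx mulr0.
- by rewrite rmorph1; apply/eqP/oner_neq0.
- by move=> x y /eqP; rewrite rmorphM mulf_eq0 => /orP [] /eqP; [left|right].
Qed.

Section MonomialIdeals.
Variables (k : fieldType) (N : nat).
Local Notation S := {mpoly k[N]}.
Implicit Types (Q : 'X_{1..N} -> Prop) (f g : S) (m u : 'X_{1..N}).
Implicit Types Z : seq 'I_N.

Definition monomial_ideal Q f := forall m, m \in msupp f -> Q m.
Definition up_closed Q := forall m u, Q m -> Q (u + m)%MM.

Lemma monomial_idealX Q m : monomial_ideal Q 'X_[m] <-> Q m.
Proof.
split=> [|h u]; last by rewrite msuppX inE => /eqP ->.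
by apply; rewrite msuppX inE.
Qed.

Lemma is_ideal_monomial Q : up_closed Q -> is_ideal (monomial_ideal Q).
Proof.
move=> hQ; split.
- by move=> m; rewrite msupp0.
- move=> f g hf hg m /msuppD_le; rewrite mem_cat.
  by case/orP; [exact: hf | exact: hg].
- move=> a f hf m /msuppM_le /allpairsP [[u v] /= [_ hv ->]].
  by apply/hQ/hf.
Qed.

Lemma monomial_ideal_sub (J : S -> Prop) Q : is_ideal J ->
  (forall m, Q m -> J 'X_[m]) -> subideal (monomial_ideal Q) J.
Proof.
move=> hJ hQ f hf; rewrite [f]mpolyE big_seq; apply: ideal_sum => // m /hf hm.
by rewrite -mul_mpolyC; case: hJ => _ _; apply; apply: hQ.
Qed.

Lemma colon_monomial Q m :
  colon (monomial_ideal Q) 'X_[m] = monomial_ideal (fun u => Q (u + m)%MM).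
Proof.
apply: ideal_ext => f; split=> hf u hu.
  apply: hf; rewrite (perm_mem (msuppMX f m)) addmC.
  by apply/mapP; exists u.
move: hu; rewrite (perm_mem (msuppMX f m)) => /mapP [u' hu' ->].
by rewrite addmC; apply: hf.
Qed.

Lemma up_closed_or Q m : up_closed Q -> up_closed (fun u => Q u \/ (m <= u)%MM).
Proof.
move=> hQ u v [/hQ|hm]; first by left.
by right; apply: lepm_trans hm _; apply: lem_addl.
Qed.

Lemma adjoin_monomial Q m : up_closed Q ->
  adjoin (monomial_ideal Q) 'X_[m] =
  monomial_ideal (fun u => Q u \/ (m <= u)%MM).
Proof.
move=> hQ; have hI := is_ideal_monomial hQ.
have hI' := is_ideal_monomial (up_closed_or (m := m) hQ).
apply: ideal_ext => f; split.
  apply: adjoin_sub => //; first by move=> g hg u /hg; left.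
  by apply/monomial_idealX; right; apply: lepm_refl.
apply: monomial_ideal_sub; first exact: is_ideal_adjoin.
move=> u [hu|hu]; first by apply/sub_adjoin/monomial_idealX.
by exists 0, 'X_[u - m]; split; [case: hI | rewrite add0r -mpolyXD submK].
Qed.

Lemma labelling_ideal_monomial n (a : 'I_n -> 'X_{1..N}) :
  labelling_ideal k a = monomial_ideal (fun u => exists v, (a v <= u)%MM).
Proof.
have hQ : up_closed (fun u => exists v, (a v <= u)%MM).
  by move=> m u [v hv]; exists v; apply: lepm_trans hv _; apply: lem_addl.
have hI := is_ideal_monomial hQ.
apply: ideal_ext => f; split.
  move=> [c ->]; apply: ideal_sum => // v _; case: (hI) => _ _; apply.
  by apply/monomial_idealX; exists v; apply: lepm_refl.
apply: monomial_ideal_sub.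
  split.
  - by exists (fun=> 0); rewrite big1 // => i _; rewrite mul0r.
  - move=> _ _ [c ->] [d ->]; exists (fun i => c i + d i).
    by rewrite -big_split /=; apply: eq_bigr => i _; rewrite mulrDl.
  - move=> b _ [c ->]; exists (fun i => b * c i).
    by rewrite mulr_sumr; apply: eq_bigr => i _; rewrite mulrA.
move=> u [v hv]; exists (fun i => if i == v then 'X_[u - a v] else 0).
rewrite (bigD1 v) //= eqxx big1 => [|i /negbTE ->]; last by rewrite mul0r.
by rewrite addr0 -mpolyXD submK.
Qed.

Definition var_ideal (Z : seq 'I_N) :=
  monomial_ideal (fun u => exists2 i, i \in Z & u i != 0%N).

Definition kill (Z : seq 'I_N) : {rmorphism S -> S} :=
  mmap (@mpolyC N k) (fun i : 'I_N => if i \in Z then 0 else 'X_i : S).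

Lemma kill_mnm Z m : mmap1 (fun i : 'I_N => if i \in Z then 0 else 'X_i : S) m =
  if [exists i, (i \in Z) && (m i != 0%N)] then 0 else 'X_[m].
Proof.
case: existsP => [[i /andP [hi hm]]|h].
  by rewrite /mmap1 (bigD1 i) //= hi expr0n (negbTE hm) mul0r.
rewrite mpolyXE_id; apply: eq_bigr => i _; case: ifP => // hi.
case: (eqVneq (m i) 0%N) => [->|hm]; first by rewrite !expr0.
by case: h; exists i; rewrite hi.
Qed.

(** A kernel of a map to a domain is prime, which gives [var_ideal_prime]. *)
Lemma var_idealE Z f : var_ideal Z f <-> kill Z f = 0.
Proof.
rewrite /= /mmap; split=> [hf|hf m hm].
  rewrite big_seq big1 // => m /hf [i hi hm]; rewrite kill_mnm.
  by case: existsP => [_|[]]; rewrite ?mulr0 //; exists i; rewrite hi.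
move/(congr1 (mcoeff m)): hf; rewrite raddf_sum mcoeff0.
rewrite (bigD1_seq m) ?msupp_uniq //= big1 => [|u hu]; last first.
  rewrite kill_mnm; case: ifP => _; first by rewrite mulr0 mcoeff0.
  by rewrite mcoeffCM mcoeffX (negbTE hu) mulr0.
rewrite addr0 kill_mnm; case: existsP => [[i /andP [hi hu]] _|_].
  by exists i.
rewrite mcoeffCM mcoeffX eqxx mulr1 => h0.
by move: hm; rewrite mcoeff_msupp h0 eqxx.
Qed.

Lemma var_ideal_prime Z : is_prime (var_ideal Z).
Proof.
rewrite (_ : var_ideal Z = fun f => kill Z f = 0); first exact: prime_ker.
by apply: ideal_ext => f; apply: var_idealE.
Qed.

Lemma is_ideal_var Z : is_ideal (var_ideal Z).
Proof. by case: (var_ideal_prime Z). Qed.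

Lemma var_idealX Z i : var_ideal Z 'X_i <-> i \in Z.
Proof.
rewrite /var_ideal monomial_idealX; split=> [[j hj]|hi].
  by rewrite mnm1E; case: (eqVneq i j) => [->|].
by exists i; rewrite // mnm1E eqxx.
Qed.

Lemma var_ideal_sub Z Z' :
  {subset Z <= Z'} -> subideal (var_ideal Z) (var_ideal Z').
Proof. by move=> h f hf m /hf [i /h hi hm]; exists i. Qed.

Lemma var_ideal_min (J : S -> Prop) Z : is_ideal J ->
  (forall i, i \in Z -> J 'X_i) -> subideal (var_ideal Z) J.
Proof.
move=> hJ hZ; apply: monomial_ideal_sub => // m [i hi hm].
rewrite -(submK (m := U_(i)) (m' := m)); last by rewrite lep1mP.
by rewrite mpolyXD; case: hJ => _ _; apply; apply: hZ.
Qed.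

Lemma var_ideal_nil f : var_ideal [::] f <-> f = 0.
Proof.
split=> [h|->]; last by case: (is_ideal_var [::]).
apply/eqP; rewrite -msupp_eq0; move: h; rewrite /var_ideal /monomial_ideal.
by case: (msupp f) => // m s /(_ m (mem_head _ _)) [].
Qed.

Lemma var_ideal_chain Z ws :
  uniq (Z ++ ws) -> nzd_chain (var_ideal Z) [seq 'X_w | w <- ws].
Proof.
elim: ws Z => [|w ws IH] Z; first by case: (var_ideal_prime Z).
rewrite uniq_catC /= mem_cat negb_or -andbA => /and3P [h1 h2 h3].
exists (var_ideal (w :: Z)); split.
- exact: is_ideal_var.
- by apply: var_ideal_sub => i hi; rewrite inE hi orbT.
- by apply/var_idealX; rewrite mem_head.
- apply: prime_nzd; first exact: var_ideal_prime.
  by rewrite var_idealX; apply/negP.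
- by apply: IH; rewrite /= uniq_catC h3 mem_cat negb_or h2 h1.
Qed.

End MonomialIdeals.

(** * Algebraic dependence *)

(** Exponent vectors are lists, so that an induction can split off the exponent of the first
    polynomial. *)
Fixpoint boxes (D d : nat) : seq (seq nat) :=
  if d is d'.+1 then [seq i :: l | i <- iota 0 D, l <- boxes D d']
  else [:: [::]].

Lemma size_boxes D d : size (boxes D d) = (D ^ d)%N.
Proof. by elim: d => //= d IH; rewrite size_allpairs size_iota IH expnS. Qed.

Lemma boxes_uniq D d : uniq (boxes D d).
Proof.
elim: d => //= d IH; apply: allpairs_uniq => //; first exact: iota_uniq.
by move=> [i l] [j l'] _ _ [-> ->].
Qed.

Fixpoint pow_list (R : comNzRingType) (l : seq nat) (s : seq R) : R :=
  match l, s with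
  | i :: l', h :: s' => h ^+ i * pow_list l' s'
  | _, _ => 1
  end.

Section Lexval.
Variables (k : fieldType) (N : nat).
Local Notation S := {mpoly k[N]}.
Implicit Types (s t : seq S) (c : seq nat -> k).

(** The first coefficient that is a [lexval] becomes the leading one: those before it vanish, and
    those after it are absorbed into the arbitrary higher term. *)
Lemma lexval_pow_sum (h : S) t D (b : nat -> S) :
  (forall i, lexval t (b i) \/ b i = 0) ->
  (exists2 i, (i < D)%N & lexval t (b i)) ->
  lexval (h :: t) (\sum_(0 <= i < D) h ^+ i * b i).
Proof.
elim: D b => [|D IH] b hb; first by case.
move=> [i hi hl]; rewrite big_nat_recl // expr0 mul1r.
set r := \sum_(0 <= i < D) h ^+ i * b i.+1.
have -> : \sum_(0 <= i < D) h ^+ i.+1 * b i.+1 = h * r.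
  by rewrite mulr_sumr; apply: eq_bigr => j _; rewrite exprS mulrA.
have [h0|h0] := hb 0%N; first by exists 0%N, (b 0%N), r; rewrite expr0 mul1r.
rewrite h0 add0r; case: i hi hl => [_ hl|i hi hl].
  by exists 0%N, (b 0%N), r; rewrite expr0 mul1r h0 add0r -h0.
have [|a [y [q [hy er]]]] := IH (fun i => b i.+1) (fun i => hb i.+1).
  by exists i.
by exists a.+1, y, q; split=> //; rewrite exprS -mulrA -er.
Qed.

(** Induction groups the terms by the exponent of the first element. The first half of the
    conclusion serves the groups whose coefficients may all be zero. *)
Lemma lexval_box s D c :
  let x := \sum_(l <- boxes D (size s)) c l *: pow_list l s in
  (lexval s x \/ x = 0) /\
  ((exists2 l, l \in boxes D (size s) & c l != 0) -> lexval s x).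
Proof.
elim: s c => [|h t IH] c /=.
  rewrite big_seq1; case: (eqVneq (c [::]) 0) => [h0|h0].
    split; first by right; rewrite h0 scale0r.
    by case=> l; rewrite inE => /eqP ->; rewrite h0 eqxx.
  have hx : exists u : S, u * (c [::] *: 1) = 1.
    exists (c [::])^-1%:MP; rewrite mul_mpolyC scalerA mulVf //.
    by rewrite scale1r.
  by split; [left|].
rewrite big_allpairs_dep.
pose b i := \sum_(l <- boxes D (size t)) c (i :: l) *: pow_list l t.
have -> : \sum_(i <- iota 0 D) \sum_(j <- boxes D (size t))
            c (i :: j) *: (h ^+ i * pow_list j t)
          = \sum_(0 <= i < D) h ^+ i * b i.
  rewrite /index_iota subn0; apply: eq_bigr => i _; rewrite /b mulr_sumr.
  by apply: eq_bigr => l _; rewrite scalerAr.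
have hb i : lexval t (b i) \/ b i = 0 by case: (IH (fun l => c (i :: l))).
split.
  case: (classic (exists2 i, (i < D)%N & lexval t (b i))) => [|hN].
    by left; apply: lexval_pow_sum.
  right; rewrite big_nat big1 // => i /andP [_ hi].
  have [hl|->] := hb i; last by rewrite mulr0.
  by case: hN; exists i.
move=> [_ /allpairsP [[i l] /= [hi hl ->]] hc].
apply: lexval_pow_sum => //; exists i; first by move: hi; rewrite mem_iota.
by case: (IH (fun l => c (i :: l))) => _; apply; exists l.
Qed.

(** [msize] is the degree plus one, and 0 for the zero polynomial; with the successors the bounds
    become additive. *)
Lemma msizeM_bound (p q : S) a b :
  (msize p <= a.+1)%N -> (msize q <= b.+1)%N -> (msize (p * q) <= (a + b).+1)%N.
Proof.
case: (eqVneq p 0) => [->|p0]; first by rewrite mul0r mmeasure0.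
case: (eqVneq q 0) => [->|q0]; first by rewrite mulr0 mmeasure0.
rewrite msizeM //; move: (msize p) (msize q) => x y; lia.
Qed.

Lemma msize_pow_list s D e l : (forall h, h \in s -> (msize h <= e.+1)%N) ->
  l \in boxes D (size s) -> (msize (pow_list l s) <= (size s * (D * e)).+1)%N.
Proof.
elim: s l => [|h t IH] l /= hs.
  by rewrite inE => /eqP ->; rewrite msize1.
move=> /allpairsP [[i l'] /= [hi hl ->]].
have hp j : (msize (h ^+ j) <= (j * e).+1)%N.
  elim: j => [|j IHj]; first by rewrite expr0 msize1.
  rewrite exprS mulSn; apply: msizeM_bound => //; apply: hs; exact: mem_head.
rewrite mulSn; apply: msizeM_bound.
  apply: leq_trans (hp i) _; rewrite ltnS leq_mul2r.
  by move: hi; rewrite mem_iota => /ltnW ->; rewrite orbT.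
by apply: IH => // g hg; apply: hs; rewrite inE hg orbT.
Qed.

Lemma card_bmultinom b : (#|{: 'X_{1..N < b}}| <= b ^ N)%N.
Proof.
have hb (m : 'X_{1..N < b}) (i : 'I_N) : (m i < b)%N.
  apply: leq_ltn_trans (bmdeg m); rewrite mdegE (bigD1 i) //=; exact: leq_addr.
pose f (m : 'X_{1..N < b}) := [ffun i => Ordinal (hb m i)].
have finj : injective f.
  move=> m m' /ffunP e; apply/val_inj/mnmP => i.
  by have := e i; rewrite !ffunE => -[].
by have := leq_card f finj; rewrite card_ffun !card_ord.
Qed.

(* Among the D^d products of powers of d > N polynomials, all of degree O(D),
   some are linearly dependent, since the polynomials of degree O(D) span a
   space of dimension O(D^N). *)
Lemma lexval_zero s : (N < size s)%N -> lexval s 0.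
Proof.
move=> hN; pose d := size s.
pose e := \max_(h <- s) msize h.
have he h : h \in s -> (msize h <= e.+1)%N.
  move=> hh; apply: leqW; rewrite /e (big_rem h) //=; exact: leq_maxl.
(* With this [D], there are at most b^N <= D^N (d e + 1)^N < D^(N+1) <= D^d monomials of degree
   below [b], fewer than the products considered. *)
pose D := ((d * e).+1 ^ N).+1.
pose b := (d * (D * e)).+1.
pose T := 'X_{1..N < b}.
pose L := boxes D d.
have hcard : (#|{: T}| < size L)%N.
  apply: leq_ltn_trans (card_bmultinom b) _; rewrite size_boxes.
  have hbD : (b <= D * (d * e).+1)%N by rewrite /b mulnS /D; nia.
  have h1 : (b ^ N <= (D * (d * e).+1) ^ N)%N.
    by case: (N) => // n0; rewrite leq_exp2r.
  apply: leq_ltn_trans h1 _; rewrite expnMn.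
  apply: (@leq_trans (D ^ N.+1)); last by rewrite leq_pexp2l.
  by rewrite expnSr ltn_pmul2l ?expn_gt0 //.
pose A : 'M[k]_(size L, #|{: T}|) :=
  \matrix_(i, j) (pow_list (nth [::] L i) s)@_(enum_val j : T).
have : kermx A != 0.
  rewrite -mxrank_eq0 mxrank_ker -lt0n subn_gt0.
  exact: leq_ltn_trans (rank_leq_col A) hcard.
case/rowV0Pn => v /sub_kermxP hv v0.
pose c l := if insub (index l L) is Some j then v 0 j else 0.
have cE (j : 'I_(size L)) : c (nth [::] L j) = v 0 j.
  by rewrite /c index_uniq ?boxes_uniq // valK.
have [_ hl] := lexval_box s D c.
suff e0 : \sum_(l <- boxes D (size s)) c l *: pow_list l s = 0.
  move: hl; rewrite e0; apply.
  case/rV0Pn: v0 => j hj; exists (nth [::] L j); first exact: mem_nth.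
  by rewrite cE.
rewrite (big_nth [::]) big_mkord; apply/mpolyP => m; rewrite mcoeff0.
rewrite raddf_sum /=; case: (ltnP (mdeg m) b) => hm.
  have := congr1 (fun M : 'rV_ _ => M 0 (enum_rank (BMultinom hm))) hv.
  rewrite !mxE => eS; rewrite -[RHS]eS; apply: eq_bigr => j _.
  by rewrite mcoeffZ cE mxE enum_rankK.
rewrite big1 // => j _; rewrite mcoeffZ.
rewrite (memN_msupp_eq0 (msize_mdeg_ge _)) ?mulr0 //.
by apply: leq_trans hm; apply: msize_pow_list => //; apply: mem_nth.
Qed.

Lemma nzd_chain_size (J : S -> Prop) s :
  is_ideal J -> nzd_chain J s -> (size s <= N)%N.
Proof.
move=> hJ hs; rewrite leqNgt; apply/negP => /lexval_zero h0.
by apply: (lexval_nzd_chain hJ hs h0); case: hJ.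
Qed.

End Lexval.

(** * Zariski's lemma *)

Section Zariski.
Variable K : fieldType.

(** Generation is phrased as an induction principle, so that a generator can be moved into the base
    ring without handling polynomial expressions. *)
Definition ring_generated (A : nzRingType) (f : A -> K) (gens : seq K) :=
  forall (B : K -> Prop), (forall x y, B x -> B y -> B (x - y)) ->
    (forall x y, B x -> B y -> B (x * y)) -> (forall a, B (f a)) ->
    (forall g, g \in gens -> B g) -> forall y, B y.

Definition algebraic_elt (A : nzRingType) (f : A -> K) (x : K) :=
  exists2 p : {poly A}, p != 0 & root (map_poly f p) x.

(** If c is the leading coefficient and n the degree, c^(n-1) times the equation for x is a monic
    equation for c x. *)
Lemma integral_lead_coef (A : idomainType) (f : {rmorphism A -> K})
    (p : {poly A}) x :
  injective f -> p != 0 -> root (map_poly f p) x ->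
  integralOver f (f (lead_coef p) * x).
Proof.
move=> finj p0 hx; pose n := (size p).-1; pose c := lead_coef p.
have sp : size p = n.+1 by rewrite prednK // size_poly_gt0.
have n0 : (0 < n)%N.
  rewrite lt0n; apply/eqP => n0.
  have ep : p = (p`_0)%:P by apply: size1_polyC; rewrite sp n0.
  move: hx; rewrite ep map_polyC /= rootC -(rmorph0 f) (inj_eq finj) => /eqP h.
  by move: p0; rewrite ep h eqxx.
pose r := \poly_(i < n) (p`_i * c ^+ (n.-1 - i)); pose q := 'X^n + r.
have sq : (size r < size ('X^n : {poly A}))%N.
  by rewrite size_polyXn ltnS size_poly.
exists q; first by rewrite monicE /q lead_coefDl // lead_coefXn.
rewrite /root rmorphD /= map_polyXn hornerD hornerXn.
rewrite (@horner_coef_wide _ n); last first.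
  by rewrite size_map_inj_poly ?rmorph0 // size_poly.
have e : f c ^+ n.-1 * (map_poly f p).[x] = 0.
  by rewrite (eqP hx) mulr0.
rewrite -[X in _ == X]e horner_coef size_map_inj_poly ?rmorph0 // sp.
rewrite big_ord_recr /= mulrDr addrC mulr_sumr; apply/eqP; congr (_ + _).
  apply: eq_bigr => i _; rewrite !coef_map coef_poly ltn_ord /=.
  rewrite rmorphM rmorphXn.
  have -> : n.-1 = (n.-1 - i + i)%N by rewrite subnK //; case: i => i /=; lia.
  by rewrite addnK exprD exprMn; ring.
rewrite coef_map /= exprMn -/(lead_coef p) -/c.
by rewrite -[in f c ^+ n](prednK n0) exprS; ring.
Qed.

Lemma common_denominator (A : idomainType) (f : {rmorphism A -> K})
    (gens : seq K) :
  injective f -> (forall g, g \in gens -> algebraic_elt f g) ->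
  exists2 s : A, s != 0 & forall g, g \in gens -> integralOver f (f s * g).
Proof.
move=> finj; elim: gens => [|g gens IH] hg.
  by exists 1; rewrite ?oner_neq0.
have [s s0 hs] : exists2 s : A, s != 0 &
    forall h, h \in gens -> integralOver f (f s * h).
  by apply: IH => h hh; apply: hg; rewrite inE hh orbT.
have [p p0 hp] := hg g (mem_head _ _).
exists (s * lead_coef p); first by rewrite mulf_neq0 // lead_coef_eq0.
move=> h; rewrite inE rmorphM => /predU1P [->|hh].
  rewrite -mulrA; apply: integral_mul; first exact: integral_id.
  exact: integral_lead_coef.
rewrite mulrAC; apply: integral_mul; first exact: hs.
exact: integral_id.
Qed.

(** Multiply a monic equation of degree n for a / b by b^n: every term except a^n is visibly a
    multiple of b. *)
Lemma integral_inverse_divides (A : idomainType) (f : {rmorphism A -> K})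
    (a b : A) :
  injective f -> b != 0 -> integralOver f (f a / f b) ->
  exists n t, a ^+ n = b * t.
Proof.
move=> finj b0 [q mq hq]; pose n := (size q).-1.
have fb0 : f b != 0 by rewrite -(rmorph0 f) (inj_eq finj).
have sq : size q = n.+1 by rewrite prednK // size_poly_gt0 monic_neq0.
pose t := - \sum_(i < n) q`_i * a ^+ i * b ^+ (n.-1 - i).
exists n, t; apply: (finj).
have := congr1 ( *%R (f b ^+ n)) (eqP hq).
rewrite mulr0 horner_coef size_map_inj_poly ?rmorph0 //.
rewrite sq big_ord_recr /=.
rewrite mulrDr coef_map /= -/(lead_coef q) (monicP mq) rmorph1 mul1r.
rewrite exprMn exprVn mulrCA divff ?expf_neq0 // mulr1.
move/eqP; rewrite addrC addr_eq0 => /eqP e.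
rewrite rmorphXn e /t rmorphM rmorphN mulrN rmorph_sum !mulr_sumr.
congr (- _); apply: eq_bigr => i _.
rewrite coef_map !rmorphM !rmorphXn /= exprMn exprVn.
have -> : f b ^+ n = f b * (f b ^+ (n.-1 - i) * f b ^+ i).
  by rewrite -exprD -exprS; congr (_ ^+ _); case: i => i /=; lia.
have := expf_neq0 i fb0; move: (f b ^+ i) => z z0.
by field.
Qed.

Lemma size_one_add_Xs (A : idomainType) (s : {poly A}) :
  s != 0 -> (1 < size (1 + 'X * s)%R)%N.
Proof.
move=> s0; have sXs : size ('X * s) = (size s).+1 by rewrite mulrC size_mulX.
by rewrite addrC size_polyDl sXs ?size_poly1 ltnS ?size_poly_gt0.
Qed.

(** Modulo b = 1 + X s the product X s is -1, so if b divided s^n it would divide (-1)^n; but b has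
    positive degree. *)
Lemma one_add_Xs_not_dvd (A : idomainType) (s t : {poly A}) n :
  s != 0 -> s ^+ n != (1 + 'X * s) * t.
Proof.
move=> s0; apply/eqP => e; pose b := 1 + 'X * s.
have sb : (1 < size b)%N by apply: size_one_add_Xs.
have [u hu] : exists u, (b - 1) ^+ n = b * u + (-1) ^+ n.
  elim: (n) => [|m [u hu]]; first by exists 0; rewrite mulr0 add0r.
  by exists ((b - 1) * u + (-1) ^+ m); rewrite !exprS hu; ring.
have eb : b * ('X^n * t - u) = (-1) ^+ n.
  have : (b - 1) ^+ n = 'X^n * (b * t).
    by rewrite /b addrC addKr -e exprMn.
  by rewrite hu => h; rewrite mulrBr mulrCA -h; ring.
have : size (b * ('X^n * t - u)) == 1%N.
  rewrite eb -signr_odd.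
  by case: odd; rewrite ?expr1 ?expr0 ?size_polyN size_poly1.
by rewrite size_mul_eq1 => /andP [/eqP h _]; rewrite h in sb.
Qed.

(* If some generator g were transcendental over A, the others would be
   algebraic over A[g], so K would be integral over A[g][1/s] for some s. But
   then 1 / (1 + g s) forces 1 + g s to divide a power of s. *)
Lemma generators_algebraic n (A : idomainType) (f : {rmorphism A -> K}) gens :
  size gens = n -> injective f -> ring_generated f gens ->
  forall g, g \in gens -> algebraic_elt f g.
Proof.
elim: n A f gens => [|n IH] A f gens sz finj hgen g hg.
  by rewrite (size0nil sz) in hg.
apply: NNPP => hN.
pose ev : {rmorphism {poly A} -> K} := horner_eval g \o map_poly f.
have evE p : ev p = (map_poly f p).[g] by [].
have evinj : injective ev.
  apply: raddf_inj => p hp; apply/eqP/negP => p0; apply: hN; exists p.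
    exact/negP.
  by rewrite /root -evE hp.
have evgen : ring_generated ev (rem g gens).
  move=> B hB hM hA hr; apply: hgen => // [a|h hh].
    by have := hA a%:P; rewrite evE map_polyC hornerC.
  case: (eqVneq h g) => [->|hne].
    by have := hA 'X; rewrite evE map_polyX hornerX.
  apply: hr; have := perm_mem (perm_to_rem hg) h.
  by rewrite hh inE (negbTE hne) /= => /esym.
have sz' : size (rem g gens) = n by rewrite size_rem // sz.
have halg := IH _ _ _ sz' evinj evgen.
have [s s0 hs] := common_denominator evinj halg.
have hall y : exists e, integralOver ev (ev s ^+ e * y).
  apply: (evgen (fun y => exists e, integralOver ev (ev s ^+ e * y))).
  - move=> x z [e he] [e' he']; exists (e + e')%N.
    rewrite mulrBr {1}exprD mulrAC [X in _ - X * _]exprD -[X in _ - X]mulrA.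
    apply: integral_sub; apply: integral_mul => //; rewrite -rmorphXn;
      exact: integral_id.
  - move=> x z [e he] [e' he']; exists (e + e')%N.
    by rewrite exprD mulrACA; apply: integral_mul.
  - by move=> a; exists 0%N; rewrite mul1r; apply: integral_id.
  - by move=> h /hs hh; exists 1%N.
have b0 : 1 + 'X * s != 0.
  by rewrite -size_poly_gt0; apply: ltnW; apply: size_one_add_Xs.
have [e] := hall (ev (1 + 'X * s))^-1.
rewrite -rmorphXn => /(integral_inverse_divides evinj b0) [m [t]].
by rewrite -exprM => /eqP; apply/negP/one_add_Xs_not_dvd.
Qed.

End Zariski.

(** * Residue fields of maximal ideals *)

Section ResidueField.
Variables (R : comNzRingType) (P : R -> Prop) (hP : is_maximal P).

(** Quotient rings need a boolean predicate, obtained by excluded middle. The maximality proof is an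
    argument so that the ideal structure can be attached to the predicate. *)
Definition maximal_pred of is_maximal P : pred R :=
  fun x => excluded_middle_informative (P x).
Local Notation memP := (maximal_pred hP).

Lemma maximal_predP x : reflect (P x) (x \in memP).
Proof.
rewrite /maximal_pred unfold_in.
by case: excluded_middle_informative => h; constructor.
Qed.

Lemma maximal_pred_closed : idealr_closed memP.
Proof.
have [hI _ _] := hP; have [h0 hD hM] := hI.
have h1 : ~ P 1 by case: hP.
split.
- exact/maximal_predP.
- exact/maximal_predP.
- move=> a x y /maximal_predP hx /maximal_predP hy; apply/maximal_predP.
  by apply: hD => //; apply: hM.
Qed.

HB.instance Definition _ := isIdealr.Build R memP maximal_pred_closed.

Definition maximal_idealr : idealr R := memP.
Definition residue := {ideal_quot maximal_idealr}.
HB.instance Definition _ := GRing.ComNzRing.on residue.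
Definition residue_map : {rmorphism R -> residue} :=
  \pi_({ideal_quot maximal_idealr})%qT.

Lemma residue_map_eq0 x : residue_map x = 0 <-> P x.
Proof.
rewrite -(rmorph0 residue_map); split=> [/eqP|h].
  by rewrite -Quotient.idealrBE subr0 => /maximal_predP.
by apply/eqP; rewrite -Quotient.idealrBE subr0; apply/maximal_predP.
Qed.

Lemma residue_map_surj y : exists x, residue_map x = y.
Proof. by exists (repr y); rewrite /= reprK. Qed.

Lemma residue_inverse (y : residue) : y != 0 -> exists z, z * y == 1.
Proof.
have [x <-] := residue_map_surj y => x0.
have hx : ~ P x by move=> /residue_map_eq0 h; rewrite h eqxx in x0.
have [hI h1 hmax] := hP.
have [[z [c [hz e]]]|hJ] :=
  hmax _ (is_ideal_adjoin x hI) (fun u hu => sub_adjoin x hu).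
  exists (residue_map c); rewrite -rmorphM -(rmorph1 residue_map) e rmorphD.
  by rewrite (residue_map_eq0 z).2 ?add0r.
by case: hx; apply/hJ/mem_adjoin.
Qed.

Definition residue_inv (y : residue) : residue :=
  if excluded_middle_informative (y != 0) is left h
  then xchoose (residue_inverse h) else 0.

Lemma residue_mulVf y : y != 0 -> residue_inv y * y = 1.
Proof.
move=> y0; rewrite /residue_inv; case: excluded_middle_informative => // h.
exact/eqP/(xchooseP (residue_inverse h)).
Qed.

Lemma residue_inv0 : residue_inv 0 = 0.
Proof.
rewrite /residue_inv; case: excluded_middle_informative => // h.
by have := h; rewrite eqxx.
Qed.

HB.instance Definition _ :=
  GRing.ComNzRing_isField.Build residue residue_mulVf residue_inv0.

End ResidueField.

Lemma maximal_residue_field (R : comNzRingType) (P : R -> Prop) :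
  is_maximal P -> exists (K : fieldType) (f : {rmorphism R -> K}),
    (forall x, f x = 0 <-> P x) /\ (forall y, exists x, f x = y).
Proof.
move=> hP; exists (residue hP), (residue_map hP).
by split; [exact: residue_map_eq0 | exact: residue_map_surj].
Qed.

Section Nullstellensatz.
Variables (k : fieldType) (N : nat).
Local Notation S := {mpoly k[N]}.

(** By surjectivity the images of the variables generate [K] over [k], so Zariski's lemma
    applies. *)
Lemma maximal_ideal_algebraic (K : fieldType) (f : {rmorphism S -> K}) i :
  (forall y, exists x, f x = y) ->
  exists2 p : {poly k}, p != 0 & root (map_poly (f \o @mpolyC N k) p) (f 'X_i).
Proof.
move=> fsurj.
apply: (@generators_algebraic K _ k (f \o @mpolyC N k)
         [seq f 'X_j | j <- enum 'I_N] erefl).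
- exact: fmorph_inj.
- move=> B hB hM hA hg y; have [x <-] := fsurj y.
  have B0 : B 0 by have := hA 0; rewrite rmorph0.
  have B1 : B 1 by have := hA 1; rewrite rmorph1.
  have hD u v : B u -> B v -> B (u + v).
    move=> hu hv; rewrite -[v]opprK; apply: (hB) => //.
    by rewrite -sub0r; apply: hB.
  rewrite [x]mpolyE rmorph_sum; apply: big_ind => // m _.
  rewrite -mul_mpolyC rmorphM; apply: (hM); first exact: hA.
  rewrite mpolyXE_id rmorph_prod; apply: big_ind => // j _.
  rewrite rmorphXn; elim: (m j) => [|e IH]; first by rewrite expr0.
  rewrite exprS; apply: hM => //; apply: hg.
  by apply/mapP; exists j; rewrite ?mem_enum.
- by apply/mapP; exists i; rewrite ?mem_enum.
Qed.

End Nullstellensatz.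

(** * Heights *)

Section Heights.
Variables (k : fieldType) (N : nat).
Local Notation S := {mpoly k[N]}.
Implicit Types (J P : S -> Prop) (Z : seq 'I_N).

Lemma var_ideal_nilE : var_ideal (k := k) (N := N) [::] = @zero_ideal S.
Proof. by apply: ideal_ext => f; apply: var_ideal_nil. Qed.

Lemma zero_sub J : is_ideal J -> subideal (@zero_ideal S) J.
Proof. by case=> h0 _ _ x ->. Qed.

(** Adding the variables of [Z] one by one gives a chain of this length. A longer chain, prolonged
    by the variables outside [Z], would exceed the bound [N] of [nzd_chain_size]. *)
Lemma has_height_var_ideal Z :
  uniq Z -> has_height (@zero_ideal S) (var_ideal Z) (size Z).
Proof.
move=> uZ; split.
  exists (fun i => var_ideal (take i Z)); split.
  - move=> i _; split; first exact: var_ideal_prime.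
    by apply: zero_sub; apply: is_ideal_var.
  - move=> i hi; split.
      apply: var_ideal_sub => j; rewrite (take_nth j) // mem_rcons inE => ->.
      by rewrite orbT.
    case: Z uZ hi => // j0 Z0 uZ hi; set Z := j0 :: Z0 in uZ hi *.
    move=> /(_ 'X_(nth j0 Z i)); rewrite !var_idealX (take_nth j0) //.
    rewrite mem_rcons mem_head => /(_ isT) /index_ltn.
    by rewrite index_uniq // ltnn.
  - by move=> x; rewrite take_size.
move=> d p hp; have [s [sz hc]] := prime_chain_nzd_chain hp.
pose W := [seq i <- enum 'I_N | i \notin Z].
have uW : uniq (Z ++ W).
  rewrite cat_uniq uZ filter_uniq ?enum_uniq // andbT.
  by apply/hasPn => i; rewrite mem_filter => /andP [].
have := hc _ _ erefl (var_ideal_chain k uW).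
have hp0 : is_ideal (p 0%N) by case: hp => /(_ 0%N isT) [[]].
move/(nzd_chain_size hp0); rewrite size_cat size_map sz.
suff eN : (size Z + size W)%N = N by rewrite -[X in (_ <= X)%N]eN leq_add2r.
rewrite -size_cat -[RHS](size_enum_ord N); apply/perm_size/uniq_perm => //.
  exact: enum_uniq.
by move=> i; rewrite mem_enum mem_cat mem_filter mem_enum andbT orbN.
Qed.

Lemma mpoly_rmorph_ext (R : comNzRingType) (f g : {rmorphism S -> R}) :
  (forall c, f c%:MP = g c%:MP) -> (forall i, f 'X_i = g 'X_i) -> f =1 g.
Proof.
move=> hC hX x; rewrite [x]mpolyE !rmorph_sum; apply: eq_bigr => m _.
rewrite -mul_mpolyC !rmorphM hC; congr (_ * _).
rewrite mpolyXE_id !rmorph_prod; apply: eq_bigr => i _.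
by rewrite !rmorphXn hX.
Qed.

Lemma mcoeff_horner_var (K : fieldType) (p : {poly K}) (i : 'I_N) e :
  ((map_poly (@mpolyC N K) p).['X_i])@_(U_(i) *+ e) = p`_e.
Proof.
rewrite (@horner_coef_wide _ (maxn (size p) e.+1)); last first.
  by rewrite size_map_inj_poly ?mpolyC0 ?leq_maxl //; apply: fmorph_inj.
rewrite raddf_sum /=.
have he : (e < maxn (size p) e.+1)%N by rewrite leq_maxr.
rewrite (bigD1 (Ordinal he)) //= big1 => [|j hj].
  by rewrite coef_map /= mcoeffCM mcoeffXn eqxx mulr1 addr0.
rewrite coef_map /= mcoeffCM mcoeffXn; case: eqP => [|_]; last by rewrite mulr0.
move/mnmP/(_ i); rewrite !mulmnE mnm1E eqxx !mul1n => /esym hje.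
by case/eqP: hj; apply: val_inj.
Qed.

Lemma sub_two_vars J z z' : is_ideal J -> J 'X_z -> J 'X_z' ->
  subideal (var_ideal [:: z; z']) J.
Proof.
move=> hJ h h'; apply: var_ideal_min => // i.
by rewrite !inE => /orP [] /eqP ->.
Qed.

(** A chain from an ideal containing two variables extends downwards by two steps, so its length is
    at most N - 2. *)
Lemma two_vars_nzd_chain J z z' s :
  is_ideal J -> z != z' -> J 'X_z -> J 'X_z' ->
  nzd_chain J s -> nzd_chain (@zero_ideal S) ('X_z :: 'X_z' :: s).
Proof.
move=> hJ hz h h' hs; rewrite -var_ideal_nilE.
have nzdv Z i : i \notin Z -> nzd (var_ideal (k := k) Z) 'X_i.
  move=> hi; apply: prime_nzd; first exact: var_ideal_prime.
  by rewrite var_idealX; apply/negP.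
exists (var_ideal [:: z]); split.
- exact: is_ideal_var.
- exact: var_ideal_sub.
- by apply/var_idealX; rewrite mem_head.
- exact: nzdv.
exists J; split=> //; last by apply: nzdv; rewrite inE eq_sym.
by apply: var_ideal_min => // i; rewrite inE => /eqP ->.
Qed.

Section MaximalHeight.
Variables (J P : S -> Prop) (z z' : 'I_N).
Hypotheses (hz : z != z') (Pz : P 'X_z) (Pz' : P 'X_z').
Hypothesis (hJ : subideal J (var_ideal [:: z; z'])).

Variables (K : fieldType) (f : {rmorphism S -> K}).
Hypothesis fker : forall x, f x = 0 <-> P x.
Hypothesis fsurj : forall y, exists x, f x = y.

Let others := [seq i <- enum 'I_N | i \notin [:: z; z']].

Let mem_others i : (i \in others) = (i \notin [:: z; z']).
Proof. by rewrite mem_filter mem_enum andbT. Qed.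

Let uniq_others : uniq others.
Proof. by rewrite filter_uniq // enum_uniq. Qed.

Lemma size_others : size others = (N - 2)%N.
Proof.
have : perm_eq ([:: z; z'] ++ others) (enum 'I_N).
  apply: uniq_perm; rewrite ?enum_uniq //.
    rewrite cat_uniq uniq_others andbT [uniq _]/= inE hz andTb.
    by apply/hasPn => i; rewrite mem_others.
  by move=> i; rewrite mem_enum mem_cat mem_others orbN.
by move/perm_size; rewrite size_cat size_enum_ord /= => e; lia.
Qed.

(* Reduction modulo z, z' and modulo P in the first i other variables; the
   kernels of these maps form a saturated chain of primes. *)
Definition partial_reduction (i : nat) : {rmorphism S -> {mpoly K[N]}} :=
  mmap (@mpolyC N K \o (f \o @mpolyC N k))
    (fun j : 'I_N => if j \in [:: z; z'] then 0
       else if (index j others < i)%N then (f 'X_j)%:MP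
       else 'X_j : {mpoly K[N]}).

Let h := partial_reduction.

Let hC i c : h i c%:MP = (f c%:MP)%:MP.
Proof. by rewrite /= mmapC. Qed.

Let hX i j : h i 'X_j = if j \in [:: z; z'] then 0
  else if (index j others < i)%N then (f 'X_j)%:MP else 'X_j.
Proof. by rewrite /= mmapX mmap1U. Qed.

(** The later map is the earlier one followed by evaluation of the next variable [w] at its
    residue. *)
Lemma partial_reduction_step i x : (i < N - 2)%N -> h i x = 0 -> h i.+1 x = 0.
Proof.
move=> hi.
pose w := nth z others i.
pose g : {rmorphism {mpoly K[N]} -> {mpoly K[N]}} :=
  mmap (@mpolyC N K)
    (fun j : 'I_N => if j == w then (f 'X_j)%:MP else 'X_j : {mpoly K[N]}).
have gC c : g c%:MP = c%:MP by rewrite /= mmapC.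
have gX j : g 'X_j = if j == w then (f 'X_j)%:MP else 'X_j.
  by rewrite /= mmapX mmap1U.
have e : h i.+1 =1 (g \o h i).
  apply: mpoly_rmorph_ext => [c|j].
    by rewrite [RHS]/= -/(h i) -/g !hC gC.
  rewrite [RHS]/= -/(h i) -/g !hX; case: ifP => hj; first by rewrite rmorph0.
  rewrite ltnS leq_eqVlt; case: ltnP => hij.
    by rewrite orbT gC.
  rewrite gX orbF; have <- : (j == w) = (index j others == i) => //.
  rewrite /w; apply/eqP/eqP => [->|<-].
    by rewrite index_uniq // size_others.
  by rewrite nth_index // mem_others hj.
by move=> h0; rewrite e [LHS]/= -/(h i) h0 rmorph0.
Qed.

(** The witness is p(x_w), where p is an algebraic equation over [k] for the residue of x_w. It dies
    once x_w is replaced by that residue, but not while x_w is still free. *)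
Lemma partial_reduction_strict i : (i < N - 2)%N ->
  exists x, h i.+1 x = 0 /\ h i x <> 0.
Proof.
move=> hi.
pose w := nth z others i.
have hw : w \in others by apply: mem_nth; rewrite size_others.
have iw : index w others = i by rewrite index_uniq // size_others.
have [p p0 hp] := maximal_ideal_algebraic w fsurj.
have hE j : h j (map_poly (@mpolyC N k) p).['X_w] =
    (map_poly (@mpolyC N K) (map_poly (f \o @mpolyC N k) p)).[h j 'X_w].
  rewrite -horner_map -!map_poly_comp; congr (_.[_]); apply: eq_map_poly => c.
  exact: hC.
move: hw; rewrite mem_others => hw.
exists (map_poly (@mpolyC N k) p).['X_w]; split.
  rewrite hE hX (negbTE hw) iw ltnSn horner_map /=.
  by rewrite (eqP hp) mpolyC0.
rewrite hE hX (negbTE hw) iw ltnn => h0.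
case/eqP: p0; apply/polyP => e; rewrite coef0.
apply: (fmorph_inj (f \o @mpolyC N k)).
rewrite rmorph0 -coef_map -(mcoeff_horner_var _ w) h0; exact: mcoeff0.
Qed.

Lemma partial_reduction_last x : h (N - 2) x = (f x)%:MP.
Proof.
rewrite -[RHS]/((@mpolyC N K \o f) x); move: x.
apply: mpoly_rmorph_ext => [c|j]; first exact: hC.
rewrite hX /=; case: ifP => hj.
  have -> : f 'X_j = 0; last by rewrite mpolyC0.
  by apply/fker; move: hj; rewrite !inE => /orP [] /eqP ->.
by rewrite -size_others index_mem mem_others hj.
Qed.

Lemma maximal_prime_chain : exists p, prime_chain J P (N - 2) p.
Proof.
exists (fun i x => h i x = 0); split.
- move=> i _; split; first exact: prime_ker.
  move=> x /hJ; apply: (@sub_two_vars (fun y => h i y = 0)).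
  + by have [] := prime_ker (h i).
  + by rewrite hX !inE eqxx.
  + by rewrite hX !inE eqxx orbT.
- move=> i hi; split; first by move=> x; apply: partial_reduction_step.
  have [x [h1 h2]] := partial_reduction_strict hi.
  by move=> /(_ x h1).
- move=> x; rewrite -fker partial_reduction_last; split=> [/eqP|->].
    by rewrite mpolyC_eq0 => /eqP.
  exact: mpolyC0.
Qed.

End MaximalHeight.

Lemma has_height_maximal J P z z' : is_maximal P -> z != z' ->
  P 'X_z -> P 'X_z' -> subideal J (var_ideal [:: z; z']) ->
  (forall Q, is_prime Q -> subideal J Q ->
     exists w w', [/\ w != w', Q 'X_w & Q 'X_w']) ->
  has_height J P (N - 2).
Proof.
move=> hP hz Pz Pz' hJ hQ; split.
  have [K [f [fker fsurj]]] := maximal_residue_field hP.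
  exact: (@maximal_prime_chain J P z z' hz Pz Pz' hJ K f fker fsurj).
move=> d p hp; have [s [sz hc]] := prime_chain_nzd_chain hp.
have [hp0 hJ0] : is_prime (p 0%N) /\ subideal J (p 0%N).
  by case: hp => /(_ 0%N isT).
have [w [w' [hw h1 h2]]] := hQ _ hp0 hJ0.
have P1 : ~ P 1 by case: hP.
have := hc _ [::] erefl P1; rewrite cats0 => hs.
have hp0I : is_ideal (p 0%N) by case: hp0.
have /(nzd_chain_size _) := two_vars_nzd_chain hp0I hw h1 h2 hs.
rewrite -var_ideal_nilE /= sz => /(_ (is_ideal_var k [::])); lia.
Qed.

End Heights.

(** * Elementary symmetric regular sequences *)

Section RegularProducts.
Variable R : comNzRingType.
Implicit Types (J : R -> Prop) (t : seq R).

Lemma colon_adjoinM J g p : is_ideal J -> nzd J g ->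
  colon (adjoin J (g * p)) g = adjoin J p.
Proof.
move=> hJ hg; have [_ _ hM] := hJ.
apply: ideal_ext => f; split=> [[y [c [hy e]]]|[y [c [hy ->]]]].
  exists (f - c * p), c; split; last by ring.
  by apply: hg; have -> : g * (f - c * p) = y by rewrite mulrBr mulrC e; ring.
by exists (g * y), c; split; [exact: hM | ring].
Qed.

Lemma adjoin_adjoinM J g p : is_ideal J ->
  adjoin (adjoin J (g * p)) g = adjoin J g.
Proof.
move=> hJ; have hJg := is_ideal_adjoin g hJ; have [_ _ hM] := hJg.
apply: ideal_ext => f; split; last first.
  by move=> [y [c [hy ->]]]; exists y, c; split=> //; apply: sub_adjoin.
apply: adjoin_sub => //; last exact: mem_adjoin.
apply: adjoin_sub => //; first by move=> x; apply: sub_adjoin.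
by apply: ideal_mulr => //; apply: mem_adjoin.
Qed.

(** The quotient by the product is filtered by the quotients by single factors, splitting off one
    factor at a time. *)
Lemma weakly_regular_prod (A : eqType) J (G : A -> R) (l : seq A) t :
  is_ideal J ->
  (forall i, i \in l -> nzd J (G i) /\ weakly_regular (adjoin J (G i)) t) ->
  weakly_regular (adjoin J (\prod_(i <- l) G i)) t.
Proof.
move=> hJ; elim: l => [|i l IH] hl.
  by rewrite big_nil; apply: weakly_regular_top => x; apply: adjoin1.
have [hi wi] := hl i (mem_head _ _); rewrite big_cons.
apply: (weakly_regular_colon_adjoin (g := G i)).
- exact: is_ideal_adjoin.
- rewrite colon_adjoinM //; apply: IH => j hj; apply: hl.
  by rewrite inE hj orbT.
- by rewrite adjoin_adjoinM.
Qed.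

(** Downward induction from the top coefficient of [q]: each coefficient of the product is one of
    [q] plus terms involving higher ones. *)
Lemma monic_mul_coef_ideal J (p q : {poly R}) : is_ideal J -> p \is monic ->
  (forall e, J (p * q)`_e) -> forall e, J q`_e.
Proof.
move=> hJ mp hpq; have [h0 hD hM] := hJ.
suff h m e : (size q - m <= e)%N -> J q`_e.
  by move=> e; apply: (h (size q)); rewrite subnn.
elim: m e => [|m IH] e he; first by rewrite nth_default // -[size q]subn0.
pose d := (size p).-1; have hd : (d < (d + e).+1)%N by lia.
have := hpq (d + e)%N; rewrite coefM (bigD1 (Ordinal hd)) //=.
rewrite addKn -/(lead_coef p) (monicP mp) mul1r => h.
set r := \sum_(j < _ | _) _ in h; rewrite -(addrK r q`_e).
apply: idealB => //; apply: ideal_sum => // j hj.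
have hjd : val j != d by apply: contra hj => /eqP hj; apply/eqP/val_inj.
case: (ltnP j d) => hj'; first by apply/hM/IH; lia.
by rewrite [p`_j]nth_default ?mul0r //; move: hjd hj'; rewrite /d /=; lia.
Qed.

End RegularProducts.

Section FreeOf.
Variables (k : fieldType) (N : nat).
Local Notation S := {mpoly k[N]}.
Implicit Types (J : S -> Prop) (j : 'I_N) (f g : S) (Z : seq 'I_N).

(** A polynomial seen as univariate in x_j. All of [S] serves as coefficient ring, although x_j
    never occurs in the coefficients. *)
Definition expand j : {rmorphism S -> {poly S}} :=
  mmap (polyC \o @mpolyC N k) (fun i => if i == j then 'X else ('X_i)%:P).

Lemma expandC j c : expand j c%:MP = c%:MP%:P.
Proof. by rewrite /= mmapC. Qed.

Lemma expandX j i : expand j 'X_i = if i == j then 'X else ('X_i)%:P.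
Proof. by rewrite /= mmapX mmap1U. Qed.

Lemma horner_expand j f : (expand j f).['X_j] = f.
Proof.
rewrite -[LHS]/((horner_eval 'X_j \o expand j) f) -[RHS]/(idfun f); move: f.
apply: mpoly_rmorph_ext => [c|i].
  by rewrite /= -/(expand j) expandC /horner_eval hornerC.
rewrite /= -/(expand j) expandX /horner_eval.
by case: eqP => [->|_]; rewrite ?hornerX ?hornerC.
Qed.

(* J is generated by polynomials that do not involve the variable j. *)
Definition free_of j J := forall f, J f -> forall e, J (expand j f)`_e.

Lemma free_of_zero j : free_of j (@zero_ideal S).
Proof. by move=> f -> e; rewrite rmorph0 coef0. Qed.

Lemma free_of_adjoin j J h : is_ideal J -> free_of j J ->
  expand j h = h%:P -> free_of j (adjoin J h).
Proof.
move=> hJ hj hh _ [y [c [hy ->]]] e.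
exists (expand j y)`_e, (expand j c)`_e; split; first exact: hj.
by rewrite rmorphD rmorphM hh coefD coefMC.
Qed.

(** Membership in [J] can be tested on the coefficients in x_j, where a monic factor cancels. *)
Lemma nzd_free_of j J g : is_ideal J -> free_of j J ->
  expand j g \is monic -> nzd J g.
Proof.
move=> hJ hj hg f /hj; rewrite rmorphM => hc.
rewrite -(horner_expand j f) horner_coef; apply: ideal_sum => // e _.
by apply: ideal_mulr => //; apply: monic_mul_coef_ideal hc _.
Qed.

Lemma adjoin_var_ideal Z i :
  adjoin (var_ideal (k := k) Z) 'X_i = var_ideal (i :: Z).
Proof.
have hI := is_ideal_var k Z; have hI' := is_ideal_var k (i :: Z).
apply: ideal_ext => f; split.
  apply: adjoin_sub => //.
    by apply: var_ideal_sub => j hj; rewrite inE hj orbT.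
  by apply/var_idealX; rewrite mem_head.
apply: var_ideal_min; first exact: is_ideal_adjoin.
move=> j; rewrite inE => /predU1P [->|hj]; first exact: mem_adjoin.
by apply/sub_adjoin/var_idealX.
Qed.

Lemma free_of_var_ideal j Z : j \notin Z -> free_of j (var_ideal (k := k) Z).
Proof.
elim: Z => [_|i Z IH]; first by rewrite var_ideal_nilE; apply: free_of_zero.
rewrite inE negb_or => /andP [hi hZ]; rewrite -adjoin_var_ideal.
apply: free_of_adjoin; [exact: is_ideal_var | exact: IH |].
by rewrite expandX eq_sym (negbTE hi).
Qed.

Section Symmetric.
Variable q : 'I_N -> {poly k}.
Hypothesis q_monic : forall i, q i \is monic.

Definition uni (i : 'I_N) : S := (map_poly (@mpolyC N k) (q i)).['X_i].

Definition elem_sym (e : nat) : S :=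
  \sum_(B : {set 'I_N} | #|B| == e) \prod_(i in B) uni i.

(** The degrees decrease: the first element is the one that becomes a single product modulo an ideal
    containing all but [d] of the [uni i]. *)
Definition elem_sym_seq (d : nat) := [seq elem_sym e | e <- rev (iota 1 d)].

Lemma expand_uni j i :
  expand j (uni i) = (map_poly (polyC \o @mpolyC N k) (q i)).[expand j 'X_i].
Proof.
rewrite /uni -horner_map -map_poly_comp; congr (_.[_]).
by apply: eq_map_poly => c; rewrite /= -/(expand j) expandC.
Qed.

Lemma expand_uni_neq j i : i != j -> expand j (uni i) = (uni i)%:P.
Proof.
move=> hij; rewrite expand_uni expandX (negbTE hij).
by rewrite map_poly_comp horner_map.
Qed.

Lemma expand_uni_monic i : expand i (uni i) \is monic.
Proof.
rewrite expand_uni expandX eqxx map_poly_comp -[X in X \is _]/(_ \Po 'X).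
by rewrite comp_polyXr monic_map.
Qed.

(** Any other index set of the same size as the complement of [A] meets [A], so its product lies in
    [J]. *)
Lemma elem_sym_mod (A : {set 'I_N}) J :
  is_ideal J -> (forall j, j \in A -> J (uni j)) ->
  J (elem_sym #|~: A| - \prod_(i in ~: A) uni i).
Proof.
move=> hJ hA; rewrite /elem_sym (bigD1 (~: A)) //= addrAC subrr add0r.
apply: ideal_sum => // B /andP [hB hne].
have [j hjB hjA] : exists2 j, j \in B & j \in A.
  case: (set_0Vmem (B :&: A)) => [h0|[j]]; last first.
    by rewrite inE => /andP []; exists j.
  case/negP: hne; rewrite eqEcard (eqP hB) leqnn andbT.
  by rewrite -disjoints_subset -setI_eq0 h0.
rewrite (bigD1 j) //=; apply: ideal_mulr => //; exact: hA.
Qed.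

(* Modulo J, the first element is a product of nonzerodivisors F_l, and
   modulo F_l the remaining ones are the elementary symmetric polynomials in
   one fewer of the F_j. *)
Lemma weakly_regular_elem_sym (A : {set 'I_N}) J : is_ideal J ->
  (forall j, j \in A -> J (uni j)) -> (forall l, l \notin A -> free_of l J) ->
  weakly_regular J (elem_sym_seq #|~: A|).
Proof.
move=> hJ hA hf; move cA: #|~: A| => m.
elim: m A J cA hJ hA hf => [|m IH] A J cA hJ hA hf //.
have -> : elem_sym_seq m.+1 = elem_sym m.+1 :: elem_sym_seq m.
  by rewrite /elem_sym_seq -[in iota 1 m.+1](addn1 m) iotaD rev_cat.
have hmod := elem_sym_mod hJ hA; rewrite cA in hmod.
have hnzd l : l \in ~: A -> nzd J (uni l).
  rewrite inE => hl; apply: (nzd_free_of hJ (hf l hl)); exact: expand_uni_monic.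
rewrite /=; split.
  apply: (nzd_mod hJ _ (_ : nzd J (\prod_(i in ~: A) uni i))).
    by rewrite -opprB; apply: idealN.
  apply: (big_ind (nzd J)) => [x|x y hx hy|l hl]; first by rewrite mul1r.
    exact: nzdM.
  exact: hnzd.
rewrite (adjoin_mod hJ hmod) -big_enum /=.
apply: weakly_regular_prod => // l; rewrite mem_enum => hl.
split; first exact: hnzd.
have hlA : l \notin A by rewrite inE in hl.
apply: (IH (l |: A)).
- by move: cA; rewrite (cardsD1 l) hl setCU setIC -setDE => -[].
- exact: is_ideal_adjoin.
- move=> j /setU1P [->|hj]; first exact: mem_adjoin.
  by apply/sub_adjoin/hA.
- move=> j; rewrite in_setU1 negb_or => /andP [hjl hj].
  by apply: free_of_adjoin; [|exact: hf|apply: expand_uni_neq; rewrite eq_sym].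
Qed.

(** The roots at 0 put [uni z] and [uni z'] into the ideal (z, z'), so the same sequence works for
    every pair. *)
Lemma weakly_regular_elem_sym_vars z z' : (forall i, root (q i) 0) -> z != z' ->
  weakly_regular (var_ideal [:: z; z']) (elem_sym_seq (N - 2)).
Proof.
move=> q0 hz; have hI := is_ideal_var k [:: z; z'].
have hc : #|~: [set z; z']| = (N - 2)%N.
  by rewrite cardsCs setCK cards2 hz card_ord.
rewrite -hc; apply: weakly_regular_elem_sym => // j; rewrite !inE => hj;
  last first.
  by apply: free_of_var_ideal; rewrite !inE.
have [r ->] : exists r, uni j = r * 'X_j.
  have /factor_theorem [r er] := q0 j.
  exists (map_poly (@mpolyC N k) r).['X_j].
  by rewrite /uni er rmorphM hornerM /= subr0 map_polyX hornerX.
by case: hI => _ _; apply; apply/var_idealX; rewrite !inE.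
Qed.

Lemma elem_sym_in P e :
  is_ideal P -> (forall i, P (uni i)) -> (0 < e)%N -> P (elem_sym e).
Proof.
move=> hP hu e0; apply: ideal_sum => // B /eqP hB.
have /set0Pn [j hj] : B != set0 by rewrite -cards_eq0 hB -lt0n.
by rewrite (bigD1 j) //=; apply: ideal_mulr.
Qed.

End Symmetric.
End FreeOf.

(** * Ideals of half trees *)

(* The combinatorics of the half trees cut out by the edges of a tree: every
   variable is attached to a half, [op] exchanges the two halves of an edge. *)
Record half_tree_system (n N : nat) (H : 'I_N -> {set 'I_n})
    (op : 'I_N -> 'I_N) := {
  half_op : forall i, H (op i) = ~: H i;
  half_opK : involutive op;
  half_ends : forall i, exists p q, [/\ p \in H i, q \notin H i &
    forall j, j != i -> j != op i -> (p \in H j) = (q \in H j)];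
  half_cross : forall i j, j != i -> j != op i ->
    [\/ H i \subset H j, H j \subset H i, H i :&: H j = set0
      | H i :|: H j = setT]
}.

Section HalfTreeIdeal.
Variables (k : fieldType) (n N : nat).
Variables (H : 'I_N -> {set 'I_n}) (op : 'I_N -> 'I_N).
Hypothesis hH : half_tree_system H op.
Local Notation S := {mpoly k[N]}.

Lemma op_neq i : op i != i.
Proof.
apply/eqP => e; have [p [q [hp _ _]]] := half_ends hH i.
by have := half_op hH i; rewrite e => /setP /(_ p); rewrite inE hp.
Qed.

(* A largest half of the family and a half containing the missing end of its
   edge will do. *)
Lemma half_tree_helly (W : {pred 'I_N}) : (0 < n)%N ->
  (forall v, exists2 i, i \in W & v \in H i) ->
  exists i j, [/\ i \in W, j \in W, i != j & H i :|: H j = setT].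
Proof.
move=> n0 hW; have [i0 hi0 _] := hW (Ordinal n0).
case: (arg_maxnP (fun i => #|H i|) hi0) => i hi hmax.
have [p [q [hp hq hpq]]] := half_ends hH i.
have [j hj hqj] := hW q; exists i, j.
have hji : j != i by apply: contra hq => /eqP <-.
split=> //; first by rewrite eq_sym.
case: (eqVneq j (op i)) => [->|hjo]; first by rewrite (half_op hH) setUCr.
have hpj : p \in H j by rewrite hpq.
case: (half_cross hH hji hjo) => // h.
- have : (#|H i| < #|H j|)%N.
    by apply: proper_card; apply/properP; split=> //; exists q.
  by have := hmax j hj; rewrite /= leqNgt => /negP.
- by rewrite (subsetP h q hqj) in hq.
- by have := in_set0 p; rewrite -h inE hp hpj.
Qed.

(** Multiples of a vertex label restricted to the variables in [B]. Labels are squarefree, so only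
    the support counts; [B] shrinks as edges are contracted. *)
Definition half_monomials (B : {set 'I_N}) (u : 'X_{1..N}) :=
  exists v, forall i, i \in B -> v \in H i -> u i != 0%N.

Lemma half_monomials_up B : up_closed (half_monomials B).
Proof.
move=> m u [v hv]; exists v => i hi hvi.
by rewrite mnmDE addn_eq0 negb_and (hv i hi hvi) orbT.
Qed.

Definition half_ideal B : S -> Prop := monomial_ideal (half_monomials B).

(** By minimality no half in [B] lies properly inside [H i], so no other edge of [B] separates two
    vertices of [H i]. *)
Lemma half_minimal_const (B : {set 'I_N}) i j v w :
  (forall j, j \in B -> op j \in B) ->
  (forall j, j \in B -> (#|H i| <= #|H j|)%N) ->
  j \in B -> j != i -> j != op i -> v \in H i -> w \in H i ->
  (v \in H j) = (w \in H j).
Proof.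
move=> hop hmin hj hji hjo hv hw.
have sub_eq l : l \in B -> H l \subset H i -> H l = H i.
  by move=> hl hs; apply/eqP; rewrite eqEcard hs hmin.
case: (half_cross hH hji hjo) => h.
- by rewrite !(subsetP h).
- by rewrite (sub_eq j hj h) hv hw.
- have out x : x \in H i -> (x \in H j) = false.
    by move=> hx; have := in_set0 x; rewrite -h inE hx.
  by rewrite !out.
- have e : H (op j) = H i.
    apply: sub_eq; first exact: hop.
    rewrite (half_op hH); apply/subsetP => x; rewrite inE => hx.
    by have := in_setT x; rewrite -h inE (negbTE hx) orbF.
  by move: hv hw; rewrite -e (half_op hH) !inE => /negbTE -> /negbTE ->.
Qed.

Lemma mnm_sum_le (l : seq 'I_N) (u : 'X_{1..N}) : uniq l ->
  ((\sum_(i <- l) U_(i))%MM <= u)%MM = all (fun i => u i != 0%N) l.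
Proof.
move=> ul; apply/mnm_lepP/allP => [h i hi|h i].
  have := h i; rewrite mnm_sumE (bigD1_seq i) //= mnm1E eqxx.
  by case: (u i).
rewrite mnm_sumE; case: (boolP (i \in l)) => hi.
  rewrite (bigD1_seq i) //= mnm1E eqxx big1 => [|j hj].
    by rewrite addn0 lt0n h.
  by rewrite mnm1E (negbTE hj).
rewrite big_seq big1 // => j hj; rewrite mnm1E.
by case: eqP => // e; rewrite -e hj in hi.
Qed.

(* Contracting a half i that contains no other half: writing y for the
   variable of op i, the colon ideal by y is the ideal of the contracted tree
   and the sum with y is (y, x) for a product x of variables. *)
Lemma weakly_regular_half_ideal (s : seq S) (B : {set 'I_N}) : (0 < n)%N ->
  (forall z z', z != z' -> weakly_regular (var_ideal [:: z; z']) s) ->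
  (forall j, j \in B -> op j \in B) -> weakly_regular (half_ideal B) s.
Proof.
move=> n0 hs; move cB: #|B| => m; elim/ltn_ind: m B cB => m IH B cB hop.
have opB j : (op j \in B) = (j \in B).
  by apply/idP/idP => /hop //; rewrite (half_opK hH).
case: (set_0Vmem B) => [->|[i0 hi0]].
  apply: weakly_regular_top => f u _.
  by exists (Ordinal n0) => i; rewrite inE.
case: (arg_minnP (fun i => #|H i|) hi0) => i hi hmin.
have [p [q [hp hq hpq]]] := half_ends hH i.
pose y := op i; pose B' := B :\: [set i; y].
have inB' j : (j \in B') = [&& j != i, j != y & j \in B].
  by rewrite !inE negb_or andbA.
have const v j : j \in B' -> v \in H i -> (v \in H j) = (q \in H j).
  rewrite inB' => /and3P [hji hjy hj] hv.
  by rewrite -hpq //; apply: (half_minimal_const hop hmin hj).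
have hyi : y != i := op_neq i.
have inHy v : (v \in H y) = (v \notin H i) by rewrite (half_op hH) inE.
apply: (weakly_regular_colon_adjoin (g := 'X_y)).
- exact/is_ideal_monomial/half_monomials_up.
- have -> : colon (half_ideal B) 'X_y = half_ideal B'.
    rewrite /half_ideal colon_monomial; congr monomial_ideal.
    apply: functional_extensionality => u; apply: propositional_extensionality.
    split=> [[v hv]|[v hv]].
      exists v => j; rewrite inB' => /and3P [hji hjy hj] hvj.
      by have := hv j hj hvj; rewrite mnmDE mnm1E (eq_sym y) (negbTE hjy) addn0.
    (* A vertex inside [H i] can be replaced by [q], just across the edge: the variables of [B'] do
       not distinguish them. *)
    have [w [hwi hw]] : exists w, w \notin H i /\
        forall j, j \in B' -> w \in H j -> u j != 0%N.
      case: (boolP (v \in H i)) => hvi; last by exists v.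
      by exists q; split=> // j hj; rewrite -(const v) //; apply: hv.
    exists w => j hj hwj; rewrite mnmDE mnm1E.
    case: (eqVneq y j) => [_|hjy]; first by rewrite addn1.
    rewrite addn0; apply: hw => //; rewrite inB' hj (eq_sym j y) hjy.
    by case: eqP => // e; rewrite -e hwj in hwi.
  apply: (IH #|B'|) => //.
    rewrite -cB; apply: proper_card; apply/properP; split.
      by apply/subsetP => j; rewrite inB' => /and3P [].
    by exists i; rewrite ?inB' ?eqxx.
  move=> j; rewrite !inB' opB (inv_eq (half_opK hH)) => /and3P [h1 h2 ->].
  by rewrite h2 (inj_eq (inv_inj (half_opK hH))) h1.
(* These are the variables of the common label of all vertices of [H i]; the labels of the other
   vertices contain [y]. *)
- pose l := [seq j <- enum 'I_N |
              [&& j \in B, j != y & (j == i) || (q \in H j)]].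
  have ul : uniq l by rewrite filter_uniq // enum_uniq.
  have -> : adjoin (half_ideal B) 'X_y =
            adjoin (var_ideal [:: y]) (\prod_(j <- l) 'X_j).
    rewrite mprodXE /half_ideal /var_ideal !adjoin_monomial; first last.
    - exact: half_monomials_up.
    - move=> a b [j hj ha]; exists j => //.
      by rewrite mnmDE addn_eq0 negb_and ha orbT.
    congr monomial_ideal; apply: functional_extensionality => u.
    apply: propositional_extensionality; rewrite lep1mP mnm_sum_le //.
    split=> [[[v hv]|hy]|[[j]|/allP hl]].
    + case: (boolP (v \in H i)) => hvi; last first.
        by left; exists y; rewrite ?mem_head //; apply: hv; rewrite ?opB ?inHy.
      right; apply/allP => j.
      rewrite mem_filter => /andP [/and3P [hj hjy hij] _].
      apply: hv => //; case: (eqVneq j i) hij => [-> //|hji] /= hqj.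
      by rewrite const // inB' hji hjy.
    + by left; exists y; rewrite ?mem_head.
    + by rewrite inE => /eqP ->; right.
    + left; exists p => j hj hpj; apply: hl.
      rewrite mem_filter mem_enum andbT hj /=.
      have hjy : j != y by apply/eqP => e; rewrite e inHy hp in hpj.
      by rewrite hjy; case: (eqVneq j i) => //= hji; rewrite -hpq.
  apply: weakly_regular_prod => [|j]; first exact: is_ideal_var.
  rewrite mem_filter => /andP [/and3P [_ hjy _] _]; split.
    apply: prime_nzd; first exact: var_ideal_prime.
    by rewrite var_idealX inE; apply/negP.
  by rewrite adjoin_var_ideal; apply: hs.
Qed.

End HalfTreeIdeal.
Arguments half_ideal k {n N} H B _.

Lemma prime_mnm (k : fieldType) (N : nat) (Q : {mpoly k[N]} -> Prop) m :
  is_prime Q -> Q 'X_[m] -> exists2 i, m i != 0%N & Q 'X_i.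
Proof.
move=> [_ Q1 QM]; have prodQ (A : Type) (s : seq A) (F : A -> {mpoly k[N]}) :
    Q (\prod_(i <- s) F i) -> exists i, Q (F i).
  elim: s => [|i s IH]; first by rewrite big_nil.
  by rewrite big_cons => /QM [|/IH //]; exists i.
rewrite mpolyXE_id => /prodQ [i hi]; exists i.
  by apply/eqP => e; rewrite e expr0 in hi.
by elim: (m i) hi => [|e IH]; rewrite ?expr0 // exprS => /QM [].
Qed.

(** * Codimension and Cohen-Macaulayness of the half-tree ideal *)

Section HalfTreeCM.
Variables (k : fieldType) (n N : nat).
Variables (H : 'I_N -> {set 'I_n}) (op : 'I_N -> 'I_N).
Hypotheses (hH : half_tree_system H op) (n0 : (0 < n)%N).
Local Notation S := {mpoly k[N]}.
Implicit Types (P Q : S -> Prop).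
Local Notation I := (half_ideal k H [set: 'I_N]).

Lemma half_ideal_sub z z' :
  H z :|: H z' = setT -> subideal I (var_ideal [:: z; z']).
Proof.
move=> hc f hf m /hf [v hv]; have := in_setT v; rewrite -hc inE.
by case/orP => /hv h; [exists z | exists z']; rewrite ?inE ?eqxx ?orbT ?h ?inE.
Qed.

(** If a monomial of [f] were divisible by no label, each vertex would lie in a half whose variable
    is missing from it. Two such halves would cover the tree, and the monomial would lie outside the
    corresponding (z, z'). *)
Lemma half_ideal_inter f :
  (forall z z', z != z' -> H z :|: H z' = setT -> var_ideal [:: z; z'] f) ->
  I f.
Proof.
move=> hf m hm; apply: NNPP => hN.
have [v|z [z' [hz hz' hzz hc]]] :=
    half_tree_helly hH (W := fun i => m i == 0%N) n0.
  apply: NNPP => hv; apply: hN; exists v => i _ hi; apply/eqP => e.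
  by apply: hv; exists i => //; rewrite unfold_in e.
have [i] := hf z z' hzz hc m hm.
rewrite !unfold_in in hz hz'.
by rewrite !inE => /orP [] /eqP ->; rewrite ?hz ?hz'.
Qed.

Lemma prime_half_vars Q : is_prime Q -> subideal I Q ->
  forall v, exists2 i, Q 'X_i & v \in H i.
Proof.
move=> hQ hI v; pose m := [multinom (v \in H i : nat) | i < N].
have [|i] := prime_mnm (m := m) hQ.
  apply: hI; apply/monomial_idealX; exists v => i _.
  by rewrite mnmE => ->.
by rewrite mnmE => hi hX; exists i => //; case: (v \in H i) hi.
Qed.

(** The second variable comes from the label of a vertex outside the half of the first, so it
    differs from it. *)
Lemma prime_two_vars Q : is_prime Q -> subideal I Q ->
  exists w w', [/\ w != w', Q 'X_w & Q 'X_w'].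
Proof.
move=> hQ /(prime_half_vars hQ) h; have [i hi _] := h (Ordinal n0).
have [p [q [_ hq _]]] := half_ends hH i.
have [j hj hqj] := h q; exists i, j; split=> //.
by apply: contra hq => /eqP ->.
Qed.

Lemma has_codim_half_ideal : (0 < N)%N -> has_codim I 2.
Proof.
move=> N0; pose i := Ordinal N0; split.
  exists (var_ideal [:: i; op i]); split.
  - exact: var_ideal_prime.
  - by apply: half_ideal_sub; rewrite (half_op hH) setUCr.
  - apply: (has_height_var_ideal k (Z := [:: i; op i])).
    by rewrite /= inE eq_sym (op_neq hH).
move=> P d hP hI [_ hmax].
have [w [w' [hw h h']]] := prime_two_vars hP hI.
have PI : is_ideal P by case: hP.
have hw' : ~ var_ideal (k := k) [:: w] 'X_w'.
  by rewrite var_idealX inE eq_sym; apply/negP.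
apply: (hmax 2%N (fun j => if j is j'.+1 then
  (if j' is 0 then var_ideal (k := k) [:: w] else P)
  else var_ideal [::])); split.
- move=> j _; have hj : is_prime (if j is j'.+1 then
      (if j' is 0 then var_ideal (k := k) [:: w] else P) else var_ideal [::]).
    by case: j => [|[|j]] //; apply: var_ideal_prime.
  by split=> //; apply: zero_sub; case: hj.
- move=> [|[|//]] _; split.
  + exact: var_ideal_sub.
  + by move=> /(_ 'X_w); rewrite !var_idealX mem_head => /(_ isT).
  + by apply: var_ideal_min => // j; rewrite inE => /eqP ->.
  + by move=> /(_ _ h').
- by [].
Qed.

(** The sequence [s] preceded by the two variables has more than [N] elements, hence the value 0;
    this is pushed along the chain 0, (z), (z, z'). *)
Lemma lexval_var_ideal (s : seq S) z z' : (N - 2 < size s)%N -> z != z' ->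
  exists2 y, lexval s y & var_ideal [:: z; z'] y.
Proof.
move=> hlt hz.
have h0 : lexval ('X_z :: 'X_z' :: s) (0 : S).
  by apply: lexval_zero; rewrite /=; lia.
have I0 Z := is_ideal_var k (N := N) Z.
have nz (Z : seq 'I_N) (i : 'I_N) :
    i \notin Z -> nzd (var_ideal (k := k) Z) 'X_i.
  move=> hi; apply: prime_nzd; first exact: var_ideal_prime.
  by rewrite var_idealX; apply/negP.
have s0 : subideal (var_ideal (k := k) (N := N) [::]) (var_ideal [:: z]).
  exact: var_ideal_sub.
have hz1 : var_ideal (k := k) [:: z] 'X_z by apply/var_idealX; rewrite mem_head.
have hz2 : var_ideal (k := k) [:: z; z'] 'X_z'.
  by apply/var_idealX; rewrite !inE eqxx orbT.
have [y1 [hy1 vy1]] := lexval_cons (I0 [:: z]) s0 hz1 (nz [::] z isT) h0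
  ((var_ideal_nil 0).2 erefl).
have s1 : subideal (var_ideal (k := k) [:: z]) (var_ideal [:: z; z']).
  by apply: var_ideal_sub => i; rewrite !inE => ->.
have [|y2 [hy2 vy2]] :=
    lexval_cons (I0 [:: z; z']) s1 hz2 (nz [:: z] z' _) hy1 vy1.
  by rewrite inE eq_sym.
by exists y2.
Qed.

(* A value of a nonzero polynomial at s in each minimal prime (z, z'); their
   product lies in the intersection I. *)
Lemma regular_half_ideal_size (s : seq S) :
  regular_seq I s -> (size s <= N - 2)%N.
Proof.
move=> hs; rewrite leqNgt; apply/negP => hlt.
have hI : is_ideal I by exact/is_ideal_monomial/half_monomials_up.
have hc := weakly_regular_nzd_chain hI hs.
have hy (c : 'I_N * 'I_N) : exists y : S, lexval s y /\
    (c.1 != c.2 -> var_ideal [:: c.1; c.2] y).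
  case: c => z z' /=; case: (eqVneq z z') => [_|hz].
    by exists 1; split=> //; apply: lexval1.
  by have [y] := lexval_var_ideal hlt hz; exists y.
have [y hy'] := fin_all_exists hy.
have hl : lexval s (\prod_(c : 'I_N * 'I_N) y c).
  by apply: lexval_prod => c _; have [] := hy' c.
apply: (lexval_nzd_chain hI hc hl); apply: half_ideal_inter => z z' hz _.
rewrite (bigD1 (z, z')) //=; apply: (ideal_mulr _ (is_ideal_var k [:: z; z'])).
by have [_] := hy' (z, z'); apply.
Qed.

Lemma cohen_macaulay_half_ideal : cohen_macaulay_quo I.
Proof.
move=> P hP hI; have [K [f [fker fsurj]]] := maximal_residue_field hP.
have PI : is_ideal P by case: hP.
have Pprime : is_prime P.
  rewrite (_ : P = fun x => f x = 0); first exact: prime_ker.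
  by apply: ideal_ext => x; split=> /fker.
pose W : {pred 'I_N} := fun i => excluded_middle_informative (P 'X_i).
have WP i : reflect (P 'X_i) (i \in W).
  by rewrite unfold_in /W; case: excluded_middle_informative => h; constructor.
(* The variables in [P] meet every label, so Helly yields a prime (z, z') between the ideal and
   [P]. *)
have [v|z [z' [/WP hz /WP hz' hzz hc]]] := half_tree_helly hH (W := W) n0.
  by have [i /WP hi hv] := prime_half_vars Pprime hI v; exists i.
exists (N - 2)%N; split.
  apply: (has_height_maximal hP hzz hz hz'); first exact: half_ideal_sub.
  exact: prime_two_vars.
have halg i : exists r : {poly k}, r \is monic /\
    root (map_poly (f \o @mpolyC N k) r) (f 'X_i).
  have [r r0 hr] := maximal_ideal_algebraic i fsurj.
  exists ((lead_coef r)^-1 *: r); split.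
    by rewrite monicE lead_coefZ mulVf ?lead_coef_eq0.
  by rewrite /root linearZ hornerZ (eqP hr) mulr0.
have [r hr] := fin_all_exists halg.
(* The factor [r i] puts the polynomial into [P], and the factor ['X] makes it vanish at 0. *)
pose q i := r i * 'X.
have mq i : q i \is monic by rewrite monicMr ?monicX //; case: (hr i).
have q0 i : root (q i) 0 by rewrite /root hornerM hornerX mulr0.
have Pq i : P (uni q i).
  apply/fker; rewrite /uni -horner_map -map_poly_comp rmorphM hornerM.
  by case: (hr i) => _ /eqP ->; rewrite mul0r.
have wr : weakly_regular I (elem_sym_seq q (N - 2)).
  apply: (weakly_regular_half_ideal hH) => // [w w' hw|i _];
    last by rewrite inE.
  exact: weakly_regular_elem_sym_vars.
have Pe e :
    (e < size (elem_sym_seq q (N - 2)))%N -> P (elem_sym_seq q (N - 2))`_e.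
  rewrite size_map => he; rewrite (nth_map 0%N) //; apply: elem_sym_in => //.
  by have := mem_nth 0%N he; rewrite mem_rev mem_iota => /andP [].
split.
  exists (elem_sym_seq q (N - 2)); split=> //.
    apply/regular_seqP; split=> // h1; case: hP => _ P1 _; apply: P1.
    exact: ideal_add_sub Pe _ h1.
  by rewrite size_map size_rev size_iota.
by move=> s hs _; apply: regular_half_ideal_size.
Qed.

End HalfTreeCM.

(** * Trees *)

Lemma edge_eq n (o : rel 'I_n) (e e' : edge o) :
  (src e, tgt e) = (src e', tgt e') -> e = e'.
Proof. by rewrite /src /tgt -!surjective_pairing => /val_inj. Qed.

Lemma edge_anti n (T o : rel 'I_n) (e e' : edge o) : is_orientation T o ->
  (src e, tgt e) <> (tgt e', src e').
Proof.
case=> _ /(_ (src e) (tgt e)) h [h1 h2].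
have h3 : o (src e) (tgt e) by exact: (valP e).
have h4 : o (tgt e) (src e) by rewrite h1 h2; exact: (valP e').
by rewrite h3 h4 in h.
Qed.

Section Tree.
Variables (n : nat) (T : rel 'I_n).
Hypothesis hT : is_tree T.
Implicit Types a b c d u v : 'I_n.

Definition cut a b : rel 'I_n :=
  [rel u v | [&& T u v, (u, v) != (a, b) & (u, v) != (b, a)]].
Definition side a b v := connect (cut a b) a v.

Lemma tree_sym : ssrbool.symmetric T. Proof. by case: hT. Qed.

Lemma tree_neq a b : T a b -> a != b.
Proof. by case: hT => _ irr _ _ _; apply: contraTneq => ->; rewrite irr. Qed.

Lemma connect_invariant (e : rel 'I_n) (P : pred 'I_n) a v :
  (forall u w, e u w -> P u -> P w) -> P a -> connect e a v -> P v.
Proof.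
move=> hP ha /connectP [p hp ->]; elim: p a ha hp => //= u p IH a ha.
by move=> /andP [/hP hu]; apply/IH/hu.
Qed.

Lemma cutC a b : cut a b =2 cut b a.
Proof. by move=> u v; congr (_ && _); apply: andbC. Qed.

Lemma cut_sym a b : ssrbool.symmetric (cut a b).
Proof.
move=> u v; rewrite /cut /= tree_sym !xpair_eqE; congr (_ && _).
by rewrite andbC ![(u == _) && _]andbC.
Qed.

Lemma side_src a b : side a b a. Proof. exact: connect0. Qed.

Lemma side_step a b c d : T c d -> (c, d) != (a, b) -> (c, d) != (b, a) ->
  side a b c = side a b d.
Proof.
move=> hcd h1 h2; have hc : cut a b c d by apply/and3P.
apply/idP/idP => h; apply: connect_trans h (connect1 _) => //.
by rewrite cut_sym.
Qed.

(** A simple path from [a] to [b] avoiding the edge would close up with it to a cycle of length at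
    least 3. *)
Lemma side_tgt a b : T a b -> side a b b = false.
Proof.
move=> hab; have [_ irr _ _ hcyc] := hT.
apply/negP => /connectP [p0 hp0 eb]; case/shortenP: hp0 eb => p hp up _ eb.
have hsub u v : cut a b u v -> T u v by case/and3P.
have := hcyc (a :: p).
rewrite /ucycle up andbT /= rcons_path -eb tree_sym hab andbT.
move=> /(_ (sub_path hsub hp)); case: p hp eb {up} => [|x [|//]] /=.
  by move=> _ e; rewrite e irr in hab.
by move=> hp e; move: hp; rewrite e /cut /= !eqxx /= andbF.
Qed.

Lemma side_opp a b v : T a b -> side b a v = ~~ side a b v.
Proof.
move=> hab; have hC : connect (cut b a) =2 connect (cut a b).
  exact: eq_connect (cutC b a).
apply/idP/idP => h.
  apply/negP => h'; have := side_tgt hab; rewrite /side.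
  have sym := sym_connect_sym (cut_sym a b).
  by rewrite (connect_trans h') // sym -hC.
have [_ _ _ conn _] := hT.
have := connect_invariant (P := fun w => side a b w || side b a w)
  _ _ (conn a v).
rewrite (negbTE h) /=; apply; last by rewrite side_src.
move=> u w huw; case: (eqVneq (u, w) (a, b)) => [[_ ->] _|h1].
  by rewrite side_src orbT.
case: (eqVneq (u, w) (b, a)) => [[_ ->] _|h2]; first by rewrite side_src.
by rewrite !(side_step huw).
Qed.

(** The component of [c] contains neither [a] nor [b], so walks inside it never use the edge between
    them. *)
Lemma side_avoid a b c d v : T a b -> T c d ->
  (c, d) != (a, b) -> (c, d) != (b, a) ->
  ~~ side c d a -> side c d v -> side a b v = side a b c.
Proof.
move=> hab hcd h1 h2 ha.
have hb : ~~ side c d b.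
  rewrite -(side_step hab) //; first by rewrite eq_sym.
  by apply: contra h2 => /eqP [-> ->].
move=> hv; apply/eqP.
have H := connect_invariant
  (P := fun w => side c d w && (side a b w == side a b c)) _ _ hv.
suff /andP [] : side c d v && (side a b v == side a b c) by [].
apply: H; last by rewrite side_src eqxx.
move=> u w huw /andP [hu /eqP <-].
have -> : side c d w by exact: connect_trans hu (connect1 huw).
case/and3P: huw => huw _ _; apply/eqP/esym/side_step => //.
  by apply: contra ha => /eqP [<- _].
by apply: contra hb => /eqP [<- _].
Qed.

(** One of the two components cut out by [c], [d] avoids the edge between [a] and [b], so it lies on
    one side of that edge; the choices give the four cases. *)
Lemma side_cross a b c d : T a b -> T c d ->
  (c, d) != (a, b) -> (c, d) != (b, a) ->
  let A := [set v | side a b v] in let C := [set v | side c d v] in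
  [\/ A \subset C, C \subset A, A :&: C = set0 | A :|: C = setT].
Proof.
move=> hab hcd h1 h2 A C; have hdc : T d c by rewrite tree_sym.
case: (boolP (side c d a)) => ha.
  have ha' : ~~ side d c a by rewrite side_opp // ha.
  have h v : side d c v -> side a b v = side a b d.
    apply: side_avoid => //.
      by apply: contra h2 => /eqP [-> ->].
    by apply: contra h1 => /eqP [-> ->].
  case: (boolP (side a b d)) => hd.
    apply: Or44; apply/setP => v; rewrite !inE orbC; apply/orP.
    case: (boolP (side c d v)) => hv; [by left | right].
    by rewrite h // side_opp.
  apply: Or41; apply/subsetP => v; rewrite !inE => hv.
  by apply: contraLR hv; rewrite -side_opp // => /h ->.
have h v : side c d v -> side a b v = side a b c by apply: side_avoid.
case: (boolP (side a b c)) => hc.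
  by apply: Or42; apply/subsetP => v; rewrite !inE => /h ->.
apply: Or43; apply/setP => v; rewrite !inE; apply/negP => /andP [hv /h].
by rewrite hv (negbTE hc).
Qed.

Lemma side_exists v u : u != v -> exists2 b, T v b & side b v u.
Proof.
move=> huv; have [_ _ _ conn _] := hT; have /connectP [p0 hp0 eb] := conn v u.
case/shortenP: hp0 eb => [[|b p]] hp up _ eb; first by rewrite eb eqxx in huv.
move: hp => /= /andP [hvb hp]; exists b => //.
apply/connectP; exists p => //.
have : v \notin b :: p by case/andP: up.
have gen x s : path T x s -> v \notin x :: s -> path (cut b v) x s.
  elim: s x => //= c s IH x /andP [hxc hs].
  rewrite !inE !negb_or => /and3P [hvx hvc hvs].
  rewrite IH ?inE ?negb_or ?hvc // andbT.
  apply/and3P; split; rewrite // xpair_eqE negb_and.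
    by rewrite (eq_sym c) hvc orbT.
  by rewrite eq_sym hvx.
by move=> hv; apply: gen.
Qed.

(** The branch at [b'] avoids the edge between [b] and [v], so it lies wholly on the side of [v]. *)
Lemma side_unique v b b' u :
  T v b -> T v b' -> side b v u -> side b' v u -> b = b'.
Proof.
move=> hb hb' h h'; apply/eqP/negPn/negP => hbb.
have hbv : T b v by rewrite tree_sym.
have hb'v : T b' v by rewrite tree_sym.
have vneq x : T x v -> x != v by exact: tree_neq.
have n1 x y : T v x -> T v y -> x != y -> side x v y = false.
  move=> hx hy hxy; rewrite -(side_step (c := v)) ?side_tgt // ?(tree_sym x) //.
    by rewrite xpair_eqE negb_and tree_neq.
  by rewrite xpair_eqE negb_and eqxx eq_sym.
have : side b v u = side b v b'.
  apply: side_avoid h' => //.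
  - by rewrite xpair_eqE eqxx andbT eq_sym.
  - by rewrite xpair_eqE negb_and vneq.
  - by rewrite n1 // eq_sym.
by rewrite h n1.
Qed.

Section TreeLabelling.
Variables (o : rel 'I_n) (ho : is_orientation T o).
Local Notation N := (num_vars o).
Implicit Types i j : 'I_N.

(* The edge of the variable i, directed towards the side away from the
   associated vertices. *)
Definition dir i : 'I_n * 'I_n :=
  match enum_val i with inl e => (src e, tgt e) | inr e => (tgt e, src e) end.

Definition half_tree i : {set 'I_n} := [set v | side (dir i).1 (dir i).2 v].

Definition opposite i : 'I_N :=
  enum_rank (match enum_val i with inl e => inr e | inr e => inl e end).

Lemma dir_opposite i : dir (opposite i) = ((dir i).2, (dir i).1).
Proof. by rewrite /dir /opposite enum_rankK; case: (enum_val i). Qed.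

Lemma oppositeK : involutive opposite.
Proof.
by move=> i; rewrite {1}/opposite enum_rankK; case E: (enum_val i) => [e|e];
  rewrite -E enum_valK.
Qed.

Lemma edge_adj (e : edge o) : T (src e) (tgt e).
Proof. by case: ho => hso _; rewrite hso /src /tgt (valP e). Qed.

Lemma dir_adj i : T (dir i).1 (dir i).2.
Proof.
rewrite /dir; case: (enum_val i) => e; first exact: edge_adj.
by rewrite tree_sym edge_adj.
Qed.

Lemma dir_inj : injective dir.
Proof.
move=> i j; rewrite /dir => h; rewrite -(enum_valK i) -(enum_valK j); move: h.
case: (enum_val i) (enum_val j) => e [] e' h; congr (enum_rank _).
- by congr inl; apply: edge_eq.
- by case: (edge_anti ho h).
- by case: (edge_anti ho (esym h)).
- by congr inr; apply: edge_eq; case: h => -> ->.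
Qed.

Lemma dir_exists a b : T a b -> exists i, dir i = (a, b).
Proof.
case: (ho) => -> _ /orP [] h.
  pose e : edge o := exist _ (a, b) h.
  by exists (enum_rank (inl e)); rewrite /dir enum_rankK.
pose e : edge o := exist _ (b, a) h.
by exists (enum_rank (inr e)); rewrite /dir enum_rankK.
Qed.

Lemma dir_neq i j : j != i -> j != opposite i ->
  (dir j != dir i) /\ (dir j != ((dir i).2, (dir i).1)).
Proof. by rewrite -dir_opposite !(inj_eq dir_inj). Qed.

Lemma dir_ends i j : j != i -> j != opposite i ->
  ((dir i).1 \in half_tree j) = ((dir i).2 \in half_tree j).
Proof.
move=> hji hjo; have [h1 h2] := dir_neq hji hjo; rewrite !inE.
case: (dir i) (dir j) (dir_adj i) h1 h2 => a b [c d] /= hab h1 h2.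
apply: side_step => //; first by rewrite eq_sym.
by apply: contra h2 => /eqP [-> ->].
Qed.

Lemma half_treeP : half_tree_system half_tree opposite.
Proof.
split.
- by move=> i; apply/setP => v; rewrite !inE dir_opposite side_opp // dir_adj.
- exact: oppositeK.
- move=> i; exists (dir i).1, (dir i).2; split.
  + by rewrite inE side_src.
  + by rewrite inE side_tgt // dir_adj.
  by move=> j; apply: dir_ends.
- move=> i j hji hjo; have [h1 h2] := dir_neq hji hjo.
  by apply: side_cross; rewrite ?dir_adj -?surjective_pairing.
Qed.

Lemma tree_labellingE v i : tree_labelling T o v i = (v \in half_tree i).
Proof.
have sum_indicator (P : pred (edge o)) (F : edge o -> edge o + edge o) e0 :
    injective F -> (\sum_(e | P e) (U_(enum_rank (F e)) : 'X_{1..N})%MM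
                      (enum_rank (F e0)))%N = P e0.
  move=> hF; have hE e :
      (U_(enum_rank (F e)) : 'X_{1..N})%MM (enum_rank (F e0)) = (e == e0).
    by rewrite mnm1E (inj_eq enum_rank_inj) (inj_eq hF).
  case: (boolP (P e0)) => h0.
    rewrite (bigD1 e0) //= hE eqxx big1 // => e /andP [_ he].
    by rewrite hE (negbTE he).
  rewrite big1 // => e he; rewrite hE.
  by case: eqP => // e1; rewrite -e1 he in h0.
have sum_zero (P : pred (edge o)) (F : edge o -> edge o + edge o)
    (c : edge o + edge o) : (forall e, F e != c) ->
    (\sum_(e | P e) (U_(enum_rank (F e)) : 'X_{1..N})%MM (enum_rank c))%N = 0%N.
  move=> hF; rewrite big1 // => e _.
  by rewrite mnm1E (inj_eq enum_rank_inj) (negbTE (hF e)).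
rewrite /tree_labelling mnmDE !mnm_sumE inE /dir -[i]enum_valK enum_rankK.
case: (enum_val i) => e0.
  rewrite (sum_indicator _ inl) ?(sum_zero _ inr) ?addn0 //; by move=> ? ? [].
rewrite (sum_indicator _ inr) ?(sum_zero _ inl) ?add0n //;
  last by move=> ? ? [].
congr nat_of_bool; apply: eq_connect => u w; exact: cutC.
Qed.

Lemma labelling_ideal_tree (k : fieldType) :
  labelling_ideal k (tree_labelling T o) = half_ideal k half_tree setT.
Proof.
rewrite labelling_ideal_monomial; congr monomial_ideal.
apply: functional_extensionality => u; apply: propositional_extensionality.
split=> -[v hv]; exists v.
  move=> i _ hi; move/mnm_lepP/(_ i): hv.
  by rewrite tree_labellingE hi; case: (u i).
apply/mnm_lepP => i; rewrite tree_labellingE.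
by case: (boolP (v \in half_tree i)) => // hi; rewrite lt0n hv.
Qed.

(** No other edge separates the two ends. Hence a morphism to [L] has prescribed values on the two
    variables of the edge up to a common summand. *)
Lemma tree_labelling_swap i :
  (tree_labelling T o (dir i).1 + U_(opposite i) =
   tree_labelling T o (dir i).2 + U_(i))%MM.
Proof.
apply/mnmP => j; rewrite [LHS]mnmDE [RHS]mnmDE !tree_labellingE !mnm1E.
have [hop opK ends _] := half_treeP.
have hd : (dir i).1 \in half_tree i by rewrite inE side_src.
have hd' : (dir i).2 \notin half_tree i by rewrite inE side_tgt // dir_adj.
have hi : opposite i != i := op_neq half_treeP i.
case: (eqVneq j i) => [->|hji].
  by rewrite hd (negbTE hd') (negbTE hi).
case: (eqVneq j (opposite i)) => [->|hjo].
  by rewrite !hop !in_setC hd hd'.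
by rewrite dir_ends.
Qed.

End TreeLabelling.
End Tree.

(** * The cellular complex *)

Lemma mpolyX_neq0 (k : fieldType) r (m : 'X_{1..r}) :
  'X_[m] != 0 :> {mpoly k[r]}.
Proof. by rewrite -msize_poly_eq0 msizeX. Qed.

Lemma mpolyX_multiple (k : fieldType) r (m m' : 'X_{1..r}) (c : {mpoly k[r]}) :
  'X_[m'] = c * 'X_[m] -> (m <= m')%MM.
Proof.
move=> e; have : m' \in msupp ('X_[m'] : {mpoly k[r]}) by rewrite msuppX inE.
rewrite e (perm_mem (msuppMX c m)) => /mapP [u _ ->]; exact: lem_addr.
Qed.

Lemma mpolyX_dvd (k : fieldType) r (m : 'X_{1..r}) (f : {mpoly k[r]}) :
  (forall u, u \in msupp f -> (m <= u)%MM) -> exists c, f = c * 'X_[m].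
Proof.
move=> hf; have h0 : up_closed (fun _ : 'X_{1..r} => False) by [].
have : adjoin (monomial_ideal (fun=> False)) 'X_[m] f.
  by rewrite adjoin_monomial // => u /hf; right.
case=> y [c [hy ->]]; exists c; suff -> : y = 0 by rewrite add0r.
apply/eqP; rewrite -msupp_eq0; move: hy; rewrite /monomial_ideal.
by case: (msupp y) => // u s /(_ u (mem_head _ _)).
Qed.

Lemma ideal_gen_vars_mnm (k : fieldType) r (m : 'X_{1..r}) i : m i != 0%N ->
  ideal_gen (fun j : 'I_r => 'X_j : {mpoly k[r]}) 'X_[m].
Proof.
move=> hi; exists (fun j => if j == i then 'X_[m - U_(i)] else 0).
rewrite (bigD1 i) //= eqxx big1 => [|j /negbTE ->]; last by rewrite mul0r.
by rewrite addr0 -mpolyXD submK // lep1mP.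
Qed.

Section Complex.
Variables (k : fieldType) (n r : nat) (T o : rel 'I_n) (a : 'I_n -> 'X_{1..r}).
Hypotheses (hT : is_tree T) (ho : is_orientation T o).
Local Notation S := {mpoly k[r]}.
Implicit Types (e : edge o) (v : 'I_n) (w : {ffun edge o -> S}).

Lemma src_neq_tgt e : src e != tgt e.
Proof. exact/(tree_neq hT)/edge_adj. Qed.

Lemma d2_coefX e v : d2_coef k a e v * 'X_[a v] =
  'X_[edge_label a e] * ((v == tgt e)%:R - (v == src e)%:R).
Proof.
rewrite /d2_coef; case: (eqVneq v (tgt e)) => [->|_].
  rewrite eq_sym (negbTE (src_neq_tgt e)) subr0 mulr1 -mpolyXD submK //.
  exact: lem_mlcmr.
case: (eqVneq v (src e)) => [->|_]; last by rewrite subrr mul0r mulr0.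
rewrite sub0r mulrN1 mulNr -mpolyXD submK //; exact: lem_mlcml.
Qed.

Lemma d2_mulX w v : d2 a w v * 'X_[a v] =
  \sum_e w e * 'X_[edge_label a e] * ((v == tgt e)%:R - (v == src e)%:R).
Proof.
rewrite ffunE mulr_suml; apply: eq_bigr => e _.
by rewrite -mulrA d2_coefX mulrA.
Qed.

Lemma sum_d2 (A : {pred 'I_n}) w : \sum_(v in A) d2 a w v * 'X_[a v] =
  \sum_e w e * 'X_[edge_label a e] * ((tgt e \in A)%:R - (src e \in A)%:R).
Proof.
have sum_eq (x : 'I_n) : \sum_(v in A) (v == x)%:R = (x \in A)%:R :> S.
  case: (boolP (x \in A)) => hx.
    rewrite (bigD1 x) //= eqxx big1 ?addr0 // => v /andP [_ /negbTE ->] //.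
  by rewrite big1 // => v hv; case: eqP => // e; rewrite -e hv in hx.
under eq_bigr do rewrite d2_mulX.
rewrite exchange_big; apply: eq_bigr => e _ /=.
by rewrite -mulr_sumr sumrB !sum_eq.
Qed.

(** Only [e] crosses its own cut, so all other terms of [sum_d2] cancel. The coefficient [w e] can
    thus be read off, whence injectivity and the candidate preimages. *)
Lemma cut_d2 e w : \sum_(v | side T (src e) (tgt e) v) d2 a w v * 'X_[a v] =
  - (w e * 'X_[edge_label a e]).
Proof.
rewrite (sum_d2 (fun v => side T (src e) (tgt e) v)) (bigD1 e) //= !unfold_in.
rewrite side_src (side_tgt hT (edge_adj ho e)) sub0r mulrN1.
rewrite big1 ?addr0 // => e' he'.
rewrite !unfold_in (side_step hT (c := src e') (d := tgt e')) ?subrr ?mulr0 //.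
- exact: edge_adj ho e'.
- exact/eqP/(edge_anti ho).
Qed.

Lemma d1_d2 w : d1 a (d2 a w) = 0.
Proof.
rewrite /d1 (eq_bigl (fun v => v \in predT)) // sum_d2 big1 // => e _.
by rewrite subrr mulr0.
Qed.

Lemma d2_injective w : d2 a w = 0 -> w = 0.
Proof.
move=> hw; apply/ffunP => e; rewrite ffunE; have := cut_d2 e w.
rewrite hw big1 => [/eqP|v _]; last by rewrite ffunE mul0r.
rewrite eq_sym oppr_eq0 mulf_eq0 (negbTE (mpolyX_neq0 _ _)) orbF => /eqP.
exact.
Qed.

Lemma sum_side_opp (G : 'I_n -> S) x y : T x y -> \sum_v G v = 0 ->
  \sum_(v | side T y x v) G v = - \sum_(v | side T x y v) G v.
Proof.
move=> hxy; rewrite (bigID (side T x y)) /= addrC => /eqP.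
by rewrite addr_eq0 => /eqP <-; apply: eq_bigl => v; rewrite side_opp.
Qed.

Lemma edge_exists x y : T x y ->
  exists e, (src e = x /\ tgt e = y) \/ (src e = y /\ tgt e = x).
Proof.
case: ho => -> _ /orP [] h; first by exists (exist _ (x, y) h); left.
by exists (exist _ (y, x) h); right.
Qed.

Lemma cut_d2_adj w x y : T x y -> exists c,
  \sum_(v | side T x y v) d2 a w v * 'X_[a v] = c * 'X_[mlcm (a x) (a y)].
Proof.
move=> hxy; have [e [[h1 h2]|[h1 h2]]] := edge_exists hxy.
  by exists (- w e); rewrite -h1 -h2 cut_d2 mulNr.
have hyx : T y x by rewrite tree_sym.
exists (w e); rewrite (sum_side_opp hyx (d1_d2 w)) -h1 -h2 cut_d2 opprK mlcmC.
by [].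
Qed.

(* The branches at v partition the other vertices. *)
Lemma sum_sides_eq0 (G : 'I_n -> S) : \sum_v G v = 0 ->
  (forall x y, T x y -> \sum_(v | side T x y v) G v = 0) -> G =1 (fun=> 0).
Proof.
move=> hG hs v.
pose branch u := odflt v [pick b | T v b && side T b v u].
have branchP u b : T v b -> u != v -> (branch u == b) = side T b v u.
  move=> hb huv; rewrite /branch; case: pickP => [b' /andP [hb' hu']|h] /=.
    apply/eqP/idP => [<- //|hu].
    exact: (side_unique hT hb' hb hu' hu).
  have [b' hb' hu'] := side_exists hT huv.
  by have := h b'; rewrite hb' hu'.
have h0 : \sum_(u | u != v) G u = 0.
  rewrite (partition_big branch (T v)) /=; last first.
    move=> u huv; have [b hb hu] := side_exists hT huv.
    by have := branchP u b hb huv; rewrite hu => /eqP ->.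
  rewrite big1 // => b hb; rewrite -[RHS](hs b v); last by rewrite tree_sym.
  apply: eq_bigl => u; case: (eqVneq u v) => [->|huv] /=.
    by rewrite side_tgt // tree_sym.
  exact: branchP.
by rewrite -hG (bigD1 v) //= h0 addr0.
Qed.

(** By [cut_d2] the preimage must be [- c e]; the difference then has zero sum on every side of
    every edge, hence vanishes at each vertex. *)
Lemma exact_of_cuts (u : {ffun 'I_n -> S}) : d1 a u = 0 ->
  (forall e, exists c, \sum_(v | side T (src e) (tgt e) v) u v * 'X_[a v] =
     c * 'X_[edge_label a e]) ->
  exists w, u = d2 a w.
Proof.
move=> hu hc; have [c hce] := fin_all_exists hc.
pose w : {ffun edge o -> S} := [ffun e => - c e]; exists w.
have h0 : (fun v => u v * 'X_[a v] - d2 a w v * 'X_[a v]) =1 (fun=> 0).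
  have hsum : \sum_v (u v * 'X_[a v] - d2 a w v * 'X_[a v]) = 0.
    by rewrite sumrB -/(d1 a u) -/(d1 a (d2 a w)) d1_d2 hu subrr.
  apply: sum_sides_eq0 => //.
  have hside e : \sum_(v | side T (src e) (tgt e) v)
      (u v * 'X_[a v] - d2 a w v * 'X_[a v]) = 0.
    by rewrite sumrB hce cut_d2 ffunE mulNr !opprK subrr.
  move=> x y hxy; have [e [[h1 h2]|[h1 h2]]] := edge_exists hxy.
    by rewrite -h1 -h2 hside.
  have hyx : T y x by rewrite tree_sym.
  by rewrite (sum_side_opp hyx hsum) -h1 -h2 hside oppr0.
apply/ffunP => v; apply: (mulIf (mpolyX_neq0 k (a v))); apply/eqP.
by rewrite -subr_eq0; apply/eqP/(h0 v).
Qed.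

End Complex.

(** * The tree labelling is in CM(T) *)

Section TreeLabellingCM.
Variables (k : fieldType) (n : nat) (T o : rel 'I_n).
Hypotheses (hT : is_tree T) (ho : is_orientation T o) (hE : exists i j, T i j).
Local Notation N := (num_vars o).
Local Notation M := (tree_labelling T o).
Local Notation S := {mpoly k[N]}.
Local Notation H := (@half_tree n T o).

Let hH : half_tree_system H (@opposite n o) := half_treeP hT ho.

Lemma tree_labelling_le i v w : v \in H i -> (M v <= M w)%MM -> w \in H i.
Proof.
move=> hv /mnm_lepP /(_ i); rewrite !tree_labellingE // hv.
by case: (w \in H i).
Qed.

Lemma half_separates v w : v != w -> exists2 i, v \in H i & w \notin H i.
Proof.
move=> hvw; have [b hb hw] : exists2 b, T v b & side T b v w.
  by apply: side_exists; rewrite // eq_sym.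
have [i hi] := dir_exists ho hb; exists i; rewrite inE hi /= ?side_src //.
by rewrite -side_opp // hw.
Qed.

Lemma tree_labelling_antichain v w : v != w -> ~~ (M v <= M w)%MM.
Proof.
by move=> /half_separates [i hv]; apply: contra; apply: tree_labelling_le.
Qed.

Section Resolution.
Variable o' : rel 'I_n.
Hypothesis ho' : is_orientation T o'.

Lemma sum_in_var_ideal (u : 'I_n -> S) (P : pred 'I_n) i :
  (forall v, P v -> v \in H i) ->
  var_ideal [:: i] (\sum_(v | P v) u v * 'X_[M v]).
Proof.
move=> hP; apply: ideal_sum; first exact: is_ideal_var.
move=> v /hP hv; have [_ _ hM] := is_ideal_var k [:: i]; apply: hM.
by apply/monomial_idealX; exists i; rewrite ?inE // tree_labellingE // hv.
Qed.

(** The least common multiple is squarefree, so its variables are treated one by one. The half of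
    each contains one whole side of [e], and the sum over either side is the same up to sign. *)
Lemma tree_cut_multiple (u : {ffun 'I_n -> S}) (e : edge o') : d1 M u = 0 ->
  exists c, \sum_(v | side T (src e) (tgt e) v) u v * 'X_[M v] =
    c * 'X_[edge_label M e].
Proof.
move=> hu; have hst := edge_adj ho' e.
have [ie hie] := dir_exists ho hst.
set s := src e in hst hie *; set t := tgt e in hst hie *.
have inHie v : (v \in H ie) = side T s t v by rewrite inE hie.
have hs : s \in H ie by rewrite inHie side_src.
have ht : t \notin H ie by rewrite inHie side_tgt.
have near i : (forall v, side T s t v -> v \in H i) ->
    var_ideal [:: i] (\sum_(v | side T s t v) u v * 'X_[M v]).
  by move=> h; apply: sum_in_var_ideal.
have far i : (forall v, ~~ side T s t v -> v \in H i) ->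
    var_ideal [:: i] (\sum_(v | side T s t v) u v * 'X_[M v]).
  move=> h; have hts : T t s by rewrite tree_sym.
  rewrite (sum_side_opp hT hts hu); apply: (idealN (is_ideal_var k [:: i])).
  by apply: sum_in_var_ideal => v; rewrite side_opp //; apply: h.
apply: mpolyX_dvd => m hm; apply/mnm_lepP => i.
rewrite mnmE !tree_labellingE // -/s -/t.
case: (boolP ((s \in H i) || (t \in H i))) => hi; last first.
  by move: hi; rewrite negb_or => /andP [/negbTE -> /negbTE ->].
suff h : var_ideal [:: i] (\sum_(v | side T s t v) u v * 'X_[M v]).
  have [j] := h m hm; rewrite inE => /eqP ->.
  by case: (m i) => // ?; case: (s \in H i); case: (t \in H i).
case: (eqVneq i ie) hi => [->|hiie] hi.
  by apply: near => v; rewrite inHie.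
case: (eqVneq i (opposite ie)) hi => [->|hio] hi.
  by apply: far => v hv; rewrite (half_op hH) inE inHie.
have hst' : (s \in H i) = (t \in H i).
  by have := dir_ends hT ho hiie hio; rewrite hie.
rewrite -hst' orbb in hi.
case: (half_cross hH hiie hio) => h.
- by apply: near => v; rewrite -inHie; apply: (subsetP h).
- by rewrite (subsetP h t) // -hst' in ht.
- by have := in_set0 s; rewrite -h inE hs hi.
- by apply: far => v hv; have := in_setT v; rewrite -h inE inHie (negbTE hv).
Qed.

Lemma tree_labelling_neq0 v : exists i, M v i != 0%N.
Proof.
have [x [y hxy]] := hE; have [i _] := dir_exists ho hxy.
case: (boolP (v \in H i)) => hv.
  by exists i; rewrite tree_labellingE // hv.
by exists (opposite i); rewrite tree_labellingE // (half_op hH) inE hv.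
Qed.

Lemma edge_label_neq (e : edge o') v : v = src e \/ v = tgt e ->
  exists i, (edge_label M e - M v)%MM i != 0%N.
Proof.
have hne := src_neq_tgt hT ho' e.
have main x y : x != y -> exists i, (mlcm (M x) (M y) - M x)%MM i != 0%N.
  rewrite eq_sym => /half_separates [i hy hx]; exists i.
  by rewrite mnmBE mnmE !tree_labellingE // hy (negbTE hx).
case=> ->; first exact: main.
by rewrite /edge_label mlcmC; apply: main; rewrite eq_sym.
Qed.

Lemma tree_labelling_resolution : cellular_minimal_free_resolution k o' M.
Proof.
split.
- by move=> w; apply: (d2_injective hT ho').
- move=> u; split=> [hu|[w ->]]; last exact: (d1_d2 _ hT ho').
  by apply: (exact_of_cuts hT ho') => // e; apply: tree_cut_multiple.
- move=> v; have [i hi] := tree_labelling_neq0 v.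
  exact: ideal_gen_vars_mnm hi.
move=> e v; rewrite /d2_coef.
case: (eqVneq v (tgt e)) => [hv|_].
  have [i hi] := edge_label_neq (or_intror hv); exact: ideal_gen_vars_mnm hi.
case: (eqVneq v (src e)) => [hv|_]; last first.
  by exists (fun=> 0); rewrite big1 // => i _; rewrite mul0r.
have [i hi] := edge_label_neq (or_introl hv).
have [c ->] := ideal_gen_vars_mnm k hi; exists (fun j => - c j).
by rewrite -sumrN; apply: eq_bigr => j _; rewrite mulNr.
Qed.

End Resolution.

Lemma incr_is_orientation : is_orientation T (incr_orientation T).
Proof.
split=> s t; rewrite /incr_orientation /= [T t s](tree_sym hT).
  rewrite -andb_orr; case hst: (T s t) => //=.
  by have := tree_neq hT hst; rewrite -(inj_eq val_inj) neq_ltn.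
apply/negP => /andP [/andP [_ h1] /andP [_ h2]].
by have := ltn_trans h1 h2; rewrite ltnn.
Qed.

Lemma tree_labelling_in_CM : in_CM k T M.
Proof.
have n0 : (0 < n)%N by case: hT.
have N0 : (0 < N)%N.
  have [x [y hxy]] := hE; have [i _] := dir_exists ho hxy.
  exact: leq_ltn_trans (ltn_ord i).
split.
- exact: tree_labelling_antichain.
- by rewrite labelling_ideal_tree //; apply: (cohen_macaulay_half_ideal hH).
- by rewrite labelling_ideal_tree //; apply: (has_codim_half_ideal _ hH).
- exact/tree_labelling_resolution/incr_is_orientation.
Qed.

End TreeLabellingCM.

(** * Morphisms from the tree labelling *)

Section MorphismsFromTree.
Variables (k : fieldType) (n : nat) (T o : rel 'I_n).
Hypotheses (hT : is_tree T) (ho : is_orientation T o).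
Local Notation N := (num_vars o).
Local Notation M := (tree_labelling T o).
Local Notation H := (@half_tree n T o).

Lemma morphism_sum r s (a : 'I_n -> 'X_{1..r}) (b : 'I_n -> 'X_{1..s}) psi u c :
  is_morphism a b psi -> psi u c = (\sum_i u i * psi U_(i)%MM c)%N.
Proof.
case=> h0 hD _.
have hn v m : (psi (v *+ m)%MM = psi v *+ m)%MM.
  elim: m => [|m IH]; first by rewrite !mulm0n h0.
  by rewrite !mulmS hD IH.
rewrite {1}[u]multinomUE_id (big_morph psi hD h0) mnm_sumE.
by apply: eq_bigr => i _; rewrite hn mulmnE mulnC.
Qed.

Lemma morphism_id r (a : 'I_n -> 'X_{1..r}) : is_morphism a a id.
Proof. by split. Qed.

Lemma morphism_comp r s t (a : 'I_n -> 'X_{1..r}) (b : 'I_n -> 'X_{1..s})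
    (c : 'I_n -> 'X_{1..t}) phi psi :
  is_morphism a b phi -> is_morphism b c psi -> is_morphism a c (psi \o phi).
Proof.
case=> h0 hD ha [g0 gD gb]; split=> [|u v|i] /=.
- by rewrite h0 g0.
- by rewrite hD gD.
- by rewrite ha gb.
Qed.

Section ToObject.
Variables (r : nat) (L : 'I_n -> 'X_{1..r}).
Hypothesis hL : in_CM k T L.

(* Otherwise L would lie in the height one prime (x_c). *)
Lemma in_CM_coord_zero c : exists v, L v c = 0%N.
Proof.
apply: NNPP => hN; have [_ _ [_ hcod] _] := hL.
have := hcod (var_ideal [:: c]) 1%N (var_ideal_prime k [:: c]).
rewrite labelling_ideal_monomial => hle.
suff : (2 <= 1)%N by [].
apply: hle; last exact: (has_height_var_ideal k (Z := [:: c])).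
move=> f hf m /hf [v /mnm_lepP /(_ c) hv]; exists c; first exact: mem_head.
apply/eqP => h0; apply: hN; exists v; apply/eqP.
by rewrite -leqn0 -h0.
Qed.

(* The syzygy between the labels of v and b is a combination of edge
   syzygies, in which the edge {a, b} must occur. *)
Lemma in_CM_unimodal a b v c : T a b -> side T a b v -> L v c = 0%N ->
  (L a c <= L b c)%N.
Proof.
move=> hab hv hv0; have [_ _ _ [_ hex _ _]] := hL.
have ho' := incr_is_orientation hT.
have hvb : v != b by apply/eqP => e; rewrite e side_tgt in hv.
pose l := mlcm (L v) (L b).
pose u : {ffun 'I_n -> {mpoly k[r]}} := [ffun w => if w == v then 'X_[l - L v]
   else if w == b then - 'X_[l - L b] else 0].
have uv : u v * 'X_[L v] = 'X_[l].
  by rewrite ffunE eqxx -mpolyXD submK // lem_mlcml.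
have ub : u b * 'X_[L b] = - 'X_[l].
  by rewrite ffunE eq_sym (negbTE hvb) eqxx mulNr -mpolyXD submK // lem_mlcmr.
have u0 w : w != v -> w != b -> u w * 'X_[L w] = 0.
  by move=> /negbTE h1 /negbTE h2; rewrite ffunE h1 h2 mul0r.
have /hex [w ew] : d1 L u = 0.
  rewrite /d1 (bigD1 v) //= (bigD1 b) /=; last by rewrite eq_sym.
  rewrite big1 => [|x /andP [h1 h2]]; last exact: u0.
  by rewrite uv ub addr0 subrr.
(* The component of [a] contains [v] but not [b], so the sum of [u] over it is just ['X_[l]], whose
   exponent at [c] is that of [L b]. *)
have [x hx] := cut_d2_adj L hT ho' w hab.
have : 'X_[l] = x * 'X_[mlcm (L a) (L b)].
  rewrite -hx -ew (bigD1 v) //= uv big1 ?addr0 // => y /andP [hy hyv].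
  by apply: u0 => //; apply/eqP => e; rewrite e side_tgt in hy.
move/mpolyX_multiple/mnm_lepP/(_ c); rewrite !mnmE hv0 max0n.
by apply: leq_trans; apply: leq_maxl.
Qed.

(* x_e goes to lcm(L_s, L_t) / L_t and y_e to lcm(L_s, L_t) / L_s, the entries
   of the Hilbert-Burch matrix of L. *)
Definition gap (i : 'I_N) : 'X_{1..r} := (L (dir i).1 - L (dir i).2)%MM.
Definition to_object (u : 'X_{1..N}) : 'X_{1..r} := (\sum_i gap i *+ u i)%MM.

Lemma to_objectE u c : to_object u c = (\sum_i u i * gap i c)%N.
Proof. by rewrite mnm_sumE; apply: eq_bigr => i _; rewrite mulmnE mulnC. Qed.

(** Only the two variables of the edge distinguish [M a] from [M b], and truncated subtraction
    satisfies (p - q) + q = (q - p) + p. *)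
Lemma to_object_step a b c : T a b ->
  (to_object (M a) c + L b c = to_object (M b) c + L a c)%N.
Proof.
move=> hab; have [i hi] := dir_exists ho hab.
have hH := half_treeP hT ho; have hne : opposite i != i := op_neq hH i.
have ha : a \in H i by rewrite inE hi side_src.
have hb : b \notin H i by rewrite inE hi side_tgt.
have split v : to_object (M v) c = ((v \in H i) * gap i c +
   ((v \notin H i) * gap (opposite i) c +
    \sum_(j | (j != i) && (j != opposite i)) (v \in H j) * gap j c))%N.
  rewrite to_objectE (bigD1 i) //= (bigD1 (opposite i)) //=.
  rewrite !tree_labellingE // (half_op hH) in_setC.
  by congr (_ + (_ + _))%N; apply: eq_bigr => j _; rewrite tree_labellingE.
have same : (\sum_(j | (j != i) && (j != opposite i)) (a \in H j) * gap j c =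
             \sum_(j | (j != i) && (j != opposite i)) (b \in H j) * gap j c)%N.
  apply: eq_bigr => j /andP [h1 h2]; congr (nat_of_bool _ * _)%N.
  by have := dir_ends hT ho h1 h2; rewrite hi.
rewrite !split ha (negbTE hb) same /gap !mnmBE dir_opposite hi /=; lia.
Qed.

Lemma to_object_morphism : is_morphism M L to_object.
Proof.
split.
- by apply/mnmP => c; rewrite to_objectE big1 ?mnm0E // => i _; rewrite mnm0E.
- move=> u v; apply/mnmP => c; rewrite mnmDE !to_objectE -big_split /=.
  by apply: eq_bigr => i _; rewrite mnmDE mulnDl.
move=> v; apply/mnmP => c; have [w hw] := in_CM_coord_zero c.
(* Coordinate [c] does not decrease across any edge directed away from [w], so the gap of every half
   containing [w] is 0 there. *)
have w0 : to_object (M w) c = 0%N.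
  rewrite to_objectE big1 // => i _; rewrite tree_labellingE //.
  case: (boolP (w \in H i)) => // hi; rewrite inE in hi.
  apply/eqP; rewrite mul1n /gap mnmBE subn_eq0.
  by apply: in_CM_unimodal hi hw; apply: dir_adj.
have [_ _ _ conn _] := hT; apply/eqP.
apply: (connect_invariant (P := fun v => to_object (M v) c == L v c)
  _ _ (conn w v)).
  move=> x y hxy /eqP hx; have := to_object_step c hxy; rewrite hx addnC.
  by move/addIn => ->.
by rewrite w0 hw.
Qed.

(** The exchange relation bounds each value of [psi] on a variable below by the gap. Both maps agree
    on the labels, so these inequalities add up to equalities, and every variable occurs in some
    label. *)
Lemma to_object_unique psi : is_morphism M L psi -> psi =1 to_object.
Proof.
move=> hpsi; have [h0 hD hM] := hpsi.
have ge i c : (gap i c <= psi U_(i)%MM c)%N.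
  have := congr1 psi (tree_labelling_swap hT ho i); rewrite [LHS]hD [RHS]hD !hM.
  move=> /mnmP /(_ c); rewrite !mnmDE /gap mnmBE; lia.
have eq i c : psi U_(i)%MM c = gap i c.
  pose v := (dir i).1; have hv : M v i = 1%N.
    by rewrite tree_labellingE // inE side_src.
  have := congr1 (fun m : 'X_{1..r} => m c) (hM v).
  rewrite (morphism_sum _ _ hpsi); have [_ _ tM] := to_object_morphism.
  rewrite -(tM v) to_objectE => /eqP.
  have hle j : (M v j * gap j c <= M v j * psi U_(j)%MM c ?= iff
      (M v j * gap j c == M v j * psi U_(j)%MM c))%N.
    by split; rewrite ?leq_mul2l ?ge ?orbT.
  rewrite eq_sym (leqif_sum (fun j _ => hle j)).2 => /forallP /(_ i) /=.
  by rewrite hv !mul1n => /eqP.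
move=> u; apply/mnmP => c; rewrite to_objectE (morphism_sum _ _ hpsi).
by apply: eq_bigr => i _; rewrite eq.
Qed.

End ToObject.
End MorphismsFromTree.

Theorem theorem2p4 (k : fieldType) (n : nat) (T o : rel 'I_n)
    (hT : is_tree T) (hE : exists i j, T i j) (ho : is_orientation T o) :
  [/\ maximal_object k T (tree_labelling T o),
      forall (r : nat) (a : 'I_n -> 'X_{1..r}), maximal_object k T a ->
        isomorphic (tree_labelling T o) a
    & forall (r : nat) (L : 'I_n -> 'X_{1..r}), in_CM k T L ->
        exists phi, is_morphism (tree_labelling T o) L phi /\
          forall psi, is_morphism (tree_labelling T o) L psi -> psi =1 phi].
Proof.
have hM := tree_labelling_in_CM k hT ho hE.
(* The labelling has no endomorphism but the identity, so composites returning to it are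
   identities. *)
have endo_id psi : is_morphism (tree_labelling T o) (tree_labelling T o) psi ->
    psi =1 id.
  move=> hpsi u; rewrite (to_object_unique hT ho hM hpsi).
  exact: esym (to_object_unique hT ho hM (morphism_id _) u).
split.
- split=> // s b hb phi hphi.
  have hpsi := to_object_morphism hT ho hb.
  have hK : cancel (to_object b) phi.
    exact: endo_id (morphism_comp hpsi hphi).
  split; last by exists (to_object b).
  by move=> u; exists (to_object b u); apply: hK.
- move=> r a [ha hmax]; have hphi := to_object_morphism hT ho ha.
  (* Maximality of [a] provides a right inverse of the morphism to [a]; it is also a left inverse by
     [endo_id]. *)
  have [_ [psi [hpsi hK]]] := hmax _ _ hM _ hphi.
  exists (to_object a), psi; split=> //.
  exact: endo_id (morphism_comp hphi hpsi).
- move=> r L hL; exists (to_object L); split.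
    exact: to_object_morphism hL.
  by move=> psi; apply: to_object_unique hL psi.
Qed.
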